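(* Let $z,c\ge 0$ and $k\in\mathbb{N}_{\ge 0}$. Let $(z_t,c_t,k_t)\in\mathbb{R}_{\ge0}^2\times\mathbb{N}_{\ge0}$ be a sequential test statistic with initial value $(z_0,c_0,k_0)=(z,c,k)$ and update rule $$z_{t+1}=z_t\,\frac{p_1(x_{t+1})}{p_0(x_{t+1})},\qquad c_{t+1}=b_{k_t}^*(z_t,c_t)-1,\qquad k_{t+1}=\begin{cases}k_t,& b_{k_t}^*(z_t,c_t)=c_t,\\ k_t-1,& b_{k_t}^*(z_t,c_t)>c_t,\end{cases}$$ where $b_k^*$ is given by $$b_k^*(z,c)=\begin{cases}c,& (k=0)\ \text{or}\ \bigl(c\ge1\ \text{and}\ C_k(z,c)\ \text{is true}\bigr),\\ \operatorname*{arg\,max}_{b\ge1} r_{k-1}(z,b),&\text{otherwise,}\end{cases}$$ and $C_k(z,c)$ denotes the condition $$\mathbb{E}_0\Bigl[\rho_k\Bigl(z\tfrac{p_1(X)}{p_0(X)},c-1\Bigr)\Bigr]\le g(z)-c\max_{b\ge c}r_{k-1}(z,b).$$ The stopping rule $$\psi_{k,t}^*=1-\frac{c_t}{b_{k_t}^*(z_t,c_t)}$$ is optimal in the sense that it attains the infimum in $\rho_k(z,c)=\inf_{\psi\in\mathcal{I}_{c,k}^\infty}\alpha(\psi)+z\,\beta(\psi)$.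
   Context: $(\mathcal{X},\mathcal{F})$ is a measurable space, $\boldsymbol{X} = (X_1,X_2,\ldots)$ a random sequence in $\mathcal{X}$, $\boldsymbol{X}_t=(X_1,\ldots,X_t)$, $\boldsymbol{x}_t=(x_1,\ldots,x_t)$. Under hypothesis $\mathcal{H}_i$, $i\in\{0,1\}$, $\boldsymbol{X}$ is i.i.d. according to $P_i$. Standing assumptions: $P_1$ is absolutely continuous with respect to $P_0$, and $D_{\mathrm{KL}}(P_0\Vert P_1)$ is non-zero and finite; $p_0,p_1$ are the densities of $P_0,P_1$ with respect to a suitable background measure. $\mathbb{E}_0$ is expectation under $\mathcal{H}_0$ (with a further subscript $\psi$ when it depends on the stopping policy), and $X$ is a generic observation. $g(z)=\min\{1,z\}$ for $z\ge0$. Writing $x^*=\operatorname{arg\,max}_x f(x)$ means that $x^*$ is a maximizer of $f$. A stopping policy is a sequence $\psi=(\psi_0,\psi_1,\ldots)$ of (measurable) functions $\psi_t=\psi_t(\boldsymbol{x}_t)\in[0,1]$ ($\psi_0$ a constant), where $\psi_t(\boldsymbol{x}_t)$ is the probability of stopping at time $t$ given that the test has not stopped before and $\boldsymbol{x}_t$ has been observed. $T$ is the resulting stopping time, with $\mathbb{P}[T=t\mid\boldsymbol{X}_t=\boldsymbol{x}_t]=\psi_t(\boldsymbol{x}_t)\prod_{n=0}^{t-1}(1-\psi_n(\boldsymbol{x}_n))$. $\mathcal{I}_c^\infty$ is the set of stopping policies $\psi$ such that, for every $\boldsymbol{x}\in\mathcal{X}^\infty$, the conditional expectation of $T$ given $\boldsymbol{X}=\boldsymbol{x}$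 is at most $c$ (equivalently, $\mathbb{E}_{\mathbf{P},\psi}[T]\le c$ for every distribution $\mathbf{P}$ of $\boldsymbol{X}$ on $\mathcal{X}^\infty$). $\mathcal{I}_{c,k}^\infty=\{\psi\in\mathcal{I}_c^\infty:\sum_{t=0}^T\mathbf{1}_{(0,1)}(\psi_t)\le k\}$, i.e. in any run of the test at most $k$ randomized stopping decisions are used. $\alpha(\psi)$ and $\beta(\psi)$ are the Type I and Type II error probabilities (the probability of deciding for $\mathcal{H}_1$ under $\mathcal{H}_0$, and for $\mathcal{H}_0$ under $\mathcal{H}_1$) of the test that uses stopping policy $\psi$ and, upon stopping at $T=t$, decides for $\mathcal{H}_1$ if $z\prod_{n=1}^t\frac{p_1(x_n)}{p_0(x_n)}>1$, for $\mathcal{H}_0$ if it is $<1$, and arbitrarily if it equals $1$. Thus $\alpha(\psi)+z\beta(\psi)=\mathbb{E}_{0,\psi}\bigl[g\bigl(z\prod_{t=1}^T\frac{p_1(X_t)}{p_0(X_t)}\bigr)\bigr]$. For $k\ge0$, $\rho_k:\mathbb{R}_{\ge0}^2\to[0,1]$ is $\rho_k(z,c)=\inf_{\psi\in\mathcal{I}_{c,k}^\infty}\alpha(\psi)+z\beta(\psi)$, and $r_k:\mathbb{R}_{\ge0}\times\mathbb{R}_{\ge1}\to[0,1]$ is $r_k(z,b)=\frac1b\bigl(g(z)-\mathbb{E}_0[\rho_k(z\frac{p_1(X)}{p_0(X)},b-1)]\bigr)$.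
   Formalization: When b* < 1 (only for k_t = 0, c_t < 1) the rule is set to ψ* = 1, since the printed formula gives 0 (or 0/0) and makes c_{t+1} negative, violating E[T] ≤ c; the arg max is taken to be any choice measurable in z, and such a choice is proved to exist. *)

(* Defs.v *)
From HB Require Import structures.
From mathcomp Require Import all_boot all_order all_algebra.
From mathcomp Require Import finmap.
From mathcomp Require Import all_classical all_reals all_analysis.

Set Implicit Arguments.
Unset Strict Implicit.
Unset Printing Implicit Defensive.
Import Order.TTheory GRing.Theory Num.Theory.
Import numFieldNormedType.Exports.
Local Open Scope classical_set_scope.
Local Open Scope ring_scope.

(* A realization of the whole sequence is x : nat -> T, where x i stands for
   the (i+1)-st observation; rules used at time t see t.-tuple T only. *)

Section Observations.
Context {d dO : measure_display} {T : measurableType d}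
        {Omega : measurableType dO} {R : realType}.

Definition history (x : nat -> T) (t : nat) : t.-tuple T :=
  [tuple x i | i < t].

Definition independent_seq (Q : probability Omega R)
    (X : nat -> {mfun Omega >-> T}) : Prop :=
  forall (J : {fset nat}) (A : nat -> set T),
    (forall i, i \in J -> measurable (A i)) ->
    Q (\bigcap_(i in [set` J]) (X i @^-1` A i)) =
    (\prod_(i <- J) Q (X i @^-1` A i))%E.

Definition iid (Q : probability Omega R) (X : nat -> {mfun Omega >-> T})
    (P : probability T R) : Prop :=
  (forall i (A : set T), measurable A -> Q (X i @^-1` A) = P A) /\
  independent_seq Q X.

Definition is_density (mu : {measure set T -> \bar R}) (P : probability T R)
    (p : T -> R) : Prop :=
  [/\ measurable_fun [set: T] p, forall x, 0 <= p x &
      forall A, measurable A -> P A = (\int[mu]_(x in A) (p x)%:E)%E].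

(* D_KL(P || Q), for P, Q with densities p, q. *)
Definition kl_divergence (P Q : probability T R) (p q : T -> R) : \bar R :=
  if `[< P `<< Q >] then (\int[P]_x (ln (p x / q x))%:E)%E else +oo%E.

(* Used both for stopping policies and for randomized tie-breaking. *)
Definition randomized_rule (phi : forall t, t.-tuple T -> R) : Prop :=
  forall t, measurable_fun [set: t.-tuple T] (phi t) /\
            forall xs, 0 <= phi t xs <= 1.

Section Policies.
Variable psi : forall t, t.-tuple T -> R.

(* P[T = t | X = x] *)
Definition stop_prob (x : nat -> T) (t : nat) : R :=
  psi (history x t) * \prod_(n < t) (1 - psi (history x n)).

(* E[T | X = x]; the second summand is the contribution of {T = oo}
   (recall +oo * 0 = 0). *)
Definition mean_run_length (x : nat -> T) : \bar R :=
  (\sum_(0 <= t <oo) (t%:R * stop_prob x t)%:E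
   + +oo * (1 - \sum_(0 <= t <oo) (stop_prob x t)%:E))%E.

Definition num_randomized (x : nat -> T) (t : nat) : nat :=
  (\sum_(n < t.+1) (0 < psi (history x n) < 1)%R)%N.

Definition admissible (c : R) : Prop :=
  randomized_rule psi /\ forall x, (mean_run_length x <= c%:E)%E.

(* "In any run": for every x and every value t that T takes with positive
   probability given x. *)
Definition admissible_rand (c : R) (k : nat) : Prop :=
  admissible c /\
  forall x t, 0 < stop_prob x t -> (num_randomized x t <= k)%N.

End Policies.

Section ErrorProbabilities.
Variables (Q0 Q1 : probability Omega R) (X : nat -> {mfun Omega >-> T}).
Variables (p0 p1 : T -> R).
Variable tie : forall t, t.-tuple T -> R.

Definition lr (x : T) : R := p1 x / p0 x.

(* Probability of deciding for H1 when stopping at t with data xs. *)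
Definition decide1 (z : R) (t : nat) (xs : t.-tuple T) : R :=
  let l := z * \prod_(x <- xs) lr x in
  if 1 < l then 1 else if l < 1 then 0 else tie xs.

Definition obs (w : Omega) : nat -> T := fun i => X i w.

Definition alpha (psi : forall t, t.-tuple T -> R) (z : R) : R :=
  fine (\sum_(0 <= t <oo)
    'E_Q0[fun w => (stop_prob psi (obs w) t *
                   decide1 z (history (obs w) t))%R])%E.

Definition beta (psi : forall t, t.-tuple T -> R) (z : R) : R :=
  fine (\sum_(0 <= t <oo)
    'E_Q1[fun w => (stop_prob psi (obs w) t *
                   (1 - decide1 z (history (obs w) t)))%R])%E.

Definition rho (k : nat) (z c : R) : R :=
  inf [set alpha psi z + z * beta psi z
      | psi in [set psi : forall t, t.-tuple T -> R
               | admissible_rand psi c k]].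

Definition g (z : R) : R := Num.min 1 z.

Variable P0 : probability T R.

Definition mean_rho (k : nat) (z c : R) : R :=
  fine 'E_P0[fun x => rho k (z * lr x) c].

Definition r (k : nat) (z b : R) : R := (g z - mean_rho k z (b - 1)) / b.

Definition is_max_on (f : R -> R) (a b : R) : Prop :=
  a <= b /\ forall b', a <= b' -> f b' <= f b.

(* The condition C_k(z, c), for k >= 1 and c >= 1. *)
Definition cond_C (k : nat) (z c : R) : Prop :=
  mean_rho k z (c - 1) <= g z - c * sup [set r k.-1 z b | b in `[c, +oo[ ].

(* amax k z is a choice of argmax_{b >= 1} r_k(z, b).  Measurability in z is
   needed for the resulting stopping rule to consist of measurable functions. *)
Definition argmax_selection (amax : nat -> R -> R) : Prop :=
  forall k : nat, measurable_fun (`[0, +oo[ : set R) (amax k) /\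
            forall z : R, 0 <= z -> is_max_on (r k z) 1 (amax k z).

Variable amax : nat -> R -> R.

Definition bstar (k : nat) (z c : R) : R :=
  if (k == 0%N) || ((1 <= c) && `[< cond_C k z c >]) then c else amax k.-1 z.

Definition next_state (s : R * R * nat) (x : T) : R * R * nat :=
  let: (z, c, k) := s in
  let b := bstar k z c in
  (z * lr x, b - 1, if c < b then k.-1 else k).

(* b < 1 happens only for k = 0 and c < 1.  Then the updated budget b - 1 would
   be negative, so no further observation is possible and the test stops. *)
Definition psi_star (z c : R) (k t : nat) (xs : t.-tuple T) : R :=
  let: (zt, ct, kt) := foldl next_state (z, c, k) xs in
  let b := bstar kt zt ct in
  if b < 1 then 1 else 1 - ct / b.

End ErrorProbabilities.
End Observations.

(* Main.v *)
Require Import Defs.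
From HB Require Import structures.
From mathcomp Require Import all_boot all_order all_algebra.
From mathcomp Require Import finmap.
From mathcomp Require Import all_classical all_reals all_analysis.
From mathcomp Require Import measurable_realfun.
From mathcomp Require Import ring lra.
Set Implicit Arguments.
Unset Strict Implicit.
Unset Printing Implicit Defensive.
Import Order.TTheory GRing.Theory Num.Theory.
Local Open Scope classical_set_scope.
Local Open Scope ring_scope.

(* Under H_0 the likelihood ratio has mean 1, and alpha + z beta of a policy is
   its expected terminal cost g(z L_T).  A stopping decision with probability
   1 - c/b turns the budget c into b, so (z, c, k) is a Markov state and rho_k
   satisfies a Bellman recursion on k and on the integer part of c: either
   continue for sure (c >= 1) with budget c - 1, or randomize, which moves along
   the chord from (0, g(z)) to (b, E_0[rho_{k-1}(z p_1(X)/p_0(X), b - 1)]); the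
   best chord has maximal slope r_{k-1}(z, b).  The recursion defines a function
   [value], shown to be a lower bound for every admissible policy and to be
   attained by the policy that follows the recursion, hence equal to rho_k.

   Two points need care.  The maximum of r_k(z, .) exists, with a measurable
   maximizer, because [value] is nonincreasing in the budget and 1-Lipschitz
   between consecutive integers.  And if the maximizer b of r_{k-1}(z, .) over
   b >= 1 lies below c, the condition C_k(z, c) holds, because rho_k lies below
   the chords of rho_{k-1} as a function of the budget. *)

(** * Law of the observed history and likelihood ratio *)

(** The constraint on T holds for every sequence, not on average, so the bound on the remaining run
    length after a continuation is the same whatever was observed; this makes the budget a
    deterministic part of the state. A randomized decision can raise the budget without bound but
    lowers k, while a sure continuation lowers the budget by 1 and keeps k: the inductions are
    lexicographic, on k and then on the integer part of c. Convexity in the budget for fixed k is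
    replaced by a comparison of mixtures at k with the value at k + 1. Since r_k and its maximizers
    are defined from rho_k itself, the policy is analysed for an abstract choice of the next budget:
    once with the slopes of [value], which identifies rho_k, then with any measurable maximizer of
    r_k. *)

Section Density.
Context {d} {T : measurableType d} {R : realType}.
Import HBNNSimple.
Local Open Scope ereal_scope.

(** Passes from indicators to simple functions to monotone limits. Used for the densities with
    respect to [mu] and for the density of [P1] with respect to [P0]. *)
Lemma ge0_integral_density (mu nu : {measure set T -> \bar R}) (p : T -> R)
    (f : T -> \bar R) :
  measurable_fun setT p -> (forall x, (0 <= p x)%R) ->
  (forall A, measurable A -> nu A = \int[mu]_(x in A) (p x)%:E) ->
  measurable_fun setT f -> (forall x, 0 <= f x) ->
  \int[nu]_x f x = \int[mu]_x (f x * (p x)%:E).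
Proof.
move=> mp p0 nuE mf f0.
have mp' : measurable_fun setT (EFin \o p) by exact/measurable_EFinP.
have indic (A : set T) : measurable A ->
    \int[nu]_x (\1_A x)%:E = \int[mu]_x ((\1_A x)%:E * (p x)%:E).
  move=> mA; rewrite integral_indic// setIT nuE// integral_mkcond.
  by apply: eq_integral => x _; rewrite epatch_indic muleC.
have simple (h : {nnsfun T >-> R}) :
    \int[nu]_x (h x)%:E = \int[mu]_x ((h x)%:E * (p x)%:E).
  pose s (y : R) (x : T) : \bar R := y%:E * (\1_(h @^-1` [set y]) x)%:E.
  have hE x : (h x)%:E = \sum_(y \in range h) s y x.
    by rewrite fimfunE -fsumEFin//; apply: eq_fsbigr => y _; rewrite /s EFinM.
  have s0 y x : 0 <= s y x by rewrite /s -EFinM nnfun_muleindic_ge0.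
  have ms y : measurable_fun setT (s y).
    by apply: measurable_funeM; apply/measurable_EFinP.
  under eq_integral do rewrite hE.
  under [RHS]eq_integral do rewrite hE ge0_mule_fsuml//.
  rewrite !ge0_integral_fsum//; last 2 first.
  - by move=> y; apply: emeasurable_funM.
  - by move=> y x _; rewrite mule_ge0// lee_fin.
  apply: eq_fsbigr => y; rewrite inE => -[x0 _ <-].
  have mh : measurable_fun setT (fun x => (\1_(h @^-1` [set h x0]) x)%:E : \bar R).
    exact/measurable_EFinP.
  rewrite /s ge0_integralZl ?lee_fin//.
  under [RHS]eq_integral do rewrite -muleA.
  rewrite [RHS]ge0_integralZl ?lee_fin//.
  - by rewrite indic.
  - by apply: emeasurable_funM.
  - by move=> x _; rewrite mule_ge0 ?lee_fin.
pose h := nnsfun_approx measurableT mf.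
have hcvg x : (h n x)%:E @[n --> \oo] --> f x by exact: cvg_nnsfun_approx.
have hnd x : nondecreasing_seq (fun n => (h n x)%:E).
  by move=> a b ab; rewrite lee_fin; exact/lefP/nd_nnsfun_approx.
have mh n : measurable_fun setT (fun x => (h n x)%:E) by exact/measurable_EFinP.
transitivity (limn (fun n => \int[nu]_x (h n x)%:E)).
  rewrite -monotone_convergence//.
  - by apply: eq_integral => x _; apply/esym/cvg_lim.
  - by move=> n x _; rewrite lee_fin.
under eq_fun do rewrite simple; rewrite -monotone_convergence//.
- by apply: eq_integral => x _; apply/cvg_lim => //; exact: cvgeZr.
- by move=> n; exact: emeasurable_funM.
- by move=> n x _; rewrite mule_ge0 ?lee_fin.
- by move=> x _ a b ab; rewrite lee_wpmul2r ?lee_fin//; have := hnd x _ _ ab.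
Qed.

End Density.

(** * Law of the first t observations *)

Section HistoryLaw.
Context {d dO} {T : measurableType d} {Omega : measurableType dO} {R : realType}.

Definition rect t (A : 'I_t -> set T) : set (t.-tuple T) :=
  [set xs | forall i, A i (tnth xs i)].

Lemma measurable_rect t (A : 'I_t -> set T) :
  (forall i, measurable (A i)) -> measurable (rect A).
Proof.
move=> mA; have -> : rect A = \bigcap_(i in [set: 'I_t]) ((@tnth t T)^~ i @^-1` A i).
  by apply/seteqP; split => xs /= Axs i; [move=> _; exact: Axs|exact: Axs].
apply: fin_bigcap_measurable => // i _.
by rewrite -[X in measurable X]setTI; exact: measurable_tnth.
Qed.

(** Rectangles form a pi-system that generates the sigma-algebra of tuples. *)
Lemma measure_rect_unique t (m1 m2 : {measure set (t.-tuple T) -> \bar R}) :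
  (m1 setT < +oo)%E ->
  (forall A : 'I_t -> set T, (forall i, measurable (A i)) ->
    m1 (rect A) = m2 (rect A)) ->
  forall B, measurable B -> m1 B = m2 B.
Proof.
move=> m1oo m12 B mB.
pose G : set (set (t.-tuple T)) :=
  [set rect A | A in [set A : 'I_t -> set T | forall i, measurable (A i)]].
have GT : G setT.
  exists (fun=> setT) => //.
  by apply/seteqP; split.
apply: (measure_unique G (fun=> setT)) => //.
- apply/seteqP; split => [C|].
    apply: smallest_sub; first exact: smallest_sigma_algebra.
    move=> D; rewrite -bigcup_seq => -[i /= _ [A mA <-]].
    (* A generator constrains one coordinate only: it is a rectangle whose other sides are full. *)
    apply: sub_sigma_algebra; exists (fun j => if j == i then A else setT).
      by move=> j; case: ifP.
    rewrite setTI; apply/seteqP; split => xs /=.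
      by move=> /(_ i); rewrite eqxx.
    by move=> Axs j; case: eqP => // ->.
  apply: smallest_sub; first exact: sigma_algebra_measurable.
  by move=> _ [A mA <-]; exact: measurable_rect.
- move=> _ _ [A mA <-] [A' mA' <-]; exists (fun i => A i `&` A' i).
    by move=> i; exact: measurableI.
  apply/seteqP; split => xs /=; first by move=> h; split=> i; case: (h i).
  by move=> [h h'] i; split.
- by apply/seteqP; split => // x _; exists 0%N.
- by move=> _ [A mA <-]; exact: m12.
Qed.

Lemma measurable_history (X : nat -> {mfun Omega >-> T}) t :
  measurable_fun setT (fun w => history (obs X w) t).
Proof.
apply/measurable_fun_tnthP => i.
rewrite (_ : _ \o _ = X i) //.
by apply/funext => w /=; rewrite tnth_mktuple.
Qed.

Definition historyRV (X : nat -> {mfun Omega >-> T}) t :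
    {mfun Omega >-> t.-tuple T} :=
  HB.pack (fun w => history (obs X w) t)
    (isMeasurableFun.Build _ _ _ _ _ (@measurable_history X t)).

Variables (Q : probability Omega R) (X : nat -> {mfun Omega >-> T}).
Variable P : probability T R.
Hypothesis iidX : iid Q X P.

Local Notation law t := (distribution Q (historyRV X t)).

Lemma history_law_rect t (A : 'I_t -> set T) : (forall i, measurable (A i)) ->
  law t (rect A) = (\prod_(i < t) P (A i))%E.
Proof.
case: iidX => idX indX mA.
(* [independent_seq] speaks of events indexed by all of nat, so the sides are extended by the full
   set beyond t. *)
pose A' (n : nat) : set T := if insub n is Some i then A i else setT.
have A'E (i : 'I_t) : A' i = A i by rewrite /A' valK.
have mA' n : measurable (A' n) by rewrite /A'; case: insubP.
pose J := [fset i | i in iota 0 t]%fset.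
have JE : perm_eq J (iota 0 t).
  apply: uniq_perm; [exact: fset_uniq|exact: iota_uniq|].
  by move=> i; rewrite !inE.
have memJ i : (i \in J) = (i < t)%N.
  by rewrite (perm_mem JE) mem_iota add0n.
have := indX J A' (fun i _ => mA' i).
have JE' : iota 0 t = index_iota 0 t by rewrite /index_iota subn0.
rewrite (perm_big _ JE) JE' big_mkord => QE.
transitivity (Q (\bigcap_(i in [set` J]) X i @^-1` A' i)).
  congr (Q _); apply/seteqP; split => w /=.
    move=> Aw i /=; rewrite memJ => it.
    by have := Aw (Ordinal it); rewrite -A'E tnth_mktuple.
  by move=> Aw i; rewrite -A'E tnth_mktuple; apply: Aw; rewrite /= memJ.
rewrite QE; apply: eq_bigr => i _.
by rewrite idX ?A'E.
Qed.

Definition cons_tuple_fun t : T * t.-tuple T -> t.+1.-tuple T :=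
  fun u => cons_tuple u.1 u.2.

Lemma measurable_cons_tuple t : measurable_fun setT (@cons_tuple_fun t).
Proof. exact: measurable_cons. Qed.

HB.instance Definition _ t :=
  isMeasurableFun.Build _ _ _ _ _ (@measurable_cons_tuple t).

Lemma ge0_integral_history0 (F : 0.-tuple T -> \bar R) :
  measurable_fun setT F -> (forall xs, 0 <= F xs)%E ->
  (\int[law 0]_xs F xs = F [tuple])%E.
Proof.
move=> mF F0; rewrite (eq_integral (fun=> F [tuple])).
  rewrite integral_cst// [X in (_ * X)%E](_ : _ = 1%E) ?mule1//.
  exact: (@probability_setT _ _ _ (law 0)).
by move=> xs _; rewrite tuple0.
Qed.

(** By independence and equal laws, the history of length t + 1 is distributed as one observation
    followed by an independent history of length t. The first observation is split off, not the
    last, since policies are unrolled from time 0. *)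
Lemma ge0_integral_historyS t (F : t.+1.-tuple T -> \bar R) :
  measurable_fun setT F -> (forall xs, 0 <= F xs)%E ->
  (\int[law t.+1]_xs F xs =
   \int[P]_x \int[law t]_xs F (cons_tuple x xs))%E.
Proof.
move=> mF F0.
transitivity (\int[pushforward (P \x law t)%E (@cons_tuple_fun t)]_xs F xs)%E.
  apply: eq_measure_integral => A mA _; apply: measure_rect_unique => //.
    by rewrite -ge0_fin_numE//; exact: fin_num_measure.
  move=> B mB; rewrite [LHS](history_law_rect mB) big_ord_recl.
  have mB' i : measurable (B (lift ord0 i)) by [].
  rewrite -(history_law_rect mB') -product_measure1E//; last first.
    exact: measurable_rect.
  rewrite /= /pushforward.
  congr ((_ \x _)%E _).
  apply/seteqP; split => -[x xs] /=.
    move=> [Bx Bxs] i; have [j ->|->] := unliftP ord0 i.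
      by rewrite tnthS; exact: Bxs.
    by rewrite tnth0.
  move=> Bxs; split; first by have := Bxs ord0; rewrite tnth0.
  by move=> i; have := Bxs (lift ord0 i); rewrite tnthS.
rewrite ge0_integral_pushforward//= preimage_setT.
rewrite fubini_tonelli1//.
exact: measurableT_comp.
Qed.

Lemma measurable_integral_history t (F : t.+1.-tuple T -> \bar R) :
  measurable_fun setT F -> (forall xs, 0 <= F xs)%E ->
  measurable_fun setT (fun x => \int[law t]_xs F (cons_tuple x xs))%E.
Proof.
move=> mF F0.
have mFc : measurable_fun setT (F \o @cons_tuple_fun t).
  exact: measurableT_comp.
have Fc0 u : (0 <= (F \o @cons_tuple_fun t) u)%E by exact: F0.
exact: (measurable_fun_fubini_tonelli_F (m2 := law t) _ mFc Fc0).
Qed.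

End HistoryLaw.

(** * The likelihood ratio as density of [P1] with respect to [P0] *)

Section LikelihoodRatio.
Context {d} {T : measurableType d} {R : realType}.
Variables (mu : {measure set T -> \bar R}) (P0 P1 : probability T R).
Variables p0 p1 : T -> R.
Hypotheses (density0 : is_density mu P0 p0) (density1 : is_density mu P1 p1).
Local Notation lr := (lr p0 p1).

Lemma lr_ge0 x : 0 <= lr x.
Proof.
by case: density0 => _ p00 _; case: density1 => _ p10 _; rewrite divr_ge0.
Qed.

Lemma measurable_lr : measurable_fun setT lr.
Proof.
case: density0 => mp0 p00 _; case: density1 => mp1 _ _.
(* The inverse is written as a power to use the measurability of [powR]; the two agree at 0 as well,
   where both are 0. *)
rewrite (_ : lr = fun x => p1 x * (p0 x) `^ (- 1)).
  by apply: measurable_funM => //; exact: measurableT_comp (measurable_powR _) _.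
by apply/funext => x; rewrite powR_inv1.
Qed.

Hypothesis P1_ac_P0 : P1 `<< P0.

(** Division by 0 gives 0, so [lr] ignores the mass of [P1] on the set [N] where [p0] vanishes; [N]
    is null for [P0], hence for [P1] by absolute continuity. *)
Lemma lr_density A : measurable A ->
  (P1 A = \int[P0]_(x in A) (lr x)%:E)%E.
Proof.
case: (density0) => mp0 p00 P0E; case: (density1) => mp1 p10 P1E mA.
pose N := p0 @^-1` [set 0].
have mN : measurable N by rewrite -[N]setTI; exact: mp0.
have P0N : P0 N = 0%E.
  by rewrite P0E//; apply: integral0_eq => x /= ->.
have P1N : P1 N = 0%E by exact: (null_content_dominatesP _ _).1 P1_ac_P0 _ mN P0N.
have -> : P1 A = P1 (A `\` N).
  rewrite (measureDI P1 mA mN) [X in (_ + X)%E](_ : _ = 0%E) ?adde0//.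
  apply/eqP; rewrite eq_le measure_ge0 andbT -P1N le_measure ?inE//.
  exact: measurableI.
rewrite P1E; last exact: measurableD.
rewrite [RHS]integral_mkcond (ge0_integral_density mp0 p00 P0E); last 2 first.
- apply/(measurable_restrictT _ mA); apply/measurable_EFinP.
  exact: measurable_funTS measurable_lr.
- by move=> x; rewrite patchE; case: ifP; rewrite ?lee_fin ?lr_ge0.
rewrite integral_mkcond; apply: eq_integral => x _.
rewrite !patchE in_setD; case: (x \in A); rewrite /= ?mul0e//.
case: (boolP (x \in N)) => xN /=; rewrite -EFinM.
  by move: xN; rewrite inE => ->; rewrite mulr0.
rewrite divfK//.
by apply: contra xN => /eqP p0x; rewrite inE.
Qed.

Lemma integral_lr : (\int[P0]_x (lr x)%:E = 1)%E.
Proof. by rewrite -lr_density// probability_setT. Qed.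

End LikelihoodRatio.

(** * Run length of a policy *)

Section RunLength.
Context {d} {T : measurableType d} {R : realType}.
Implicit Types (psi : forall t, t.-tuple T -> R) (x : nat -> T).

(** The policy still to be run after continuing at time 0 and observing [a]; the one-step equations
    relate [psi] to it. *)
Definition shift_rule (a : T) psi : forall t, t.-tuple T -> R :=
  fun t xs => psi t.+1 (cons_tuple a xs).

Lemma history0 x : history x 0 = [tuple].
Proof. by rewrite tuple0. Qed.

Lemma historyS x t :
  history x t.+1 = cons_tuple (x 0%N) (history (x \o succn) t).
Proof.
apply: eq_from_tnth => i; rewrite tnth_mktuple.
have [j ->|->] := unliftP ord0 i; last by rewrite tnth0.
by rewrite tnthS tnth_mktuple.
Qed.

Lemma stop_prob0 psi x : stop_prob psi x 0 = psi 0%N [tuple].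
Proof. by rewrite /stop_prob big_ord0 mulr1 history0. Qed.

Lemma stop_probS psi x t :
  stop_prob psi x t.+1 =
  (1 - psi 0%N [tuple]) * stop_prob (shift_rule (x 0%N) psi) (x \o succn) t.
Proof.
rewrite /stop_prob big_ord_recl history0 /= mulrCA; congr (_ * (_ * _)).
  by rewrite historyS.
by apply: eq_bigr => i _; rewrite historyS.
Qed.

Lemma num_randomizedS psi x t :
  num_randomized psi x t.+1 =
  ((0 < psi 0%N [tuple] < 1)%R +
   num_randomized (shift_rule (x 0%N) psi) (x \o succn) t)%N.
Proof.
rewrite /num_randomized big_ord_recl history0; congr addn.
by apply: eq_bigr => i _; rewrite historyS.
Qed.

Lemma randomized_rule_shift psi a :
  randomized_rule psi -> randomized_rule (shift_rule a psi).
Proof.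
move=> rpsi t; split; last by move=> xs; apply: (rpsi t.+1).2.
apply: (measurableT_comp (rpsi t.+1).1).
exact: measurable_cons.
Qed.

Section rule.
Variable psi : forall t, t.-tuple T -> R.
Hypothesis rpsi : randomized_rule psi.

Lemma rule_ge0 t (xs : t.-tuple T) : 0 <= psi xs.
Proof. by case/andP: ((rpsi t).2 xs). Qed.

Lemma rule_le1 t (xs : t.-tuple T) : psi xs <= 1.
Proof. by case/andP: ((rpsi t).2 xs). Qed.

Lemma stop_prob_ge0 x t : 0 <= stop_prob psi x t.
Proof.
rewrite mulr_ge0 ?rule_ge0// prodr_ge0// => i _.
by rewrite subr_ge0 rule_le1.
Qed.

Lemma sum_stop_prob x n :
  \sum_(t < n) stop_prob psi x t = 1 - \prod_(t < n) (1 - psi (history x t)).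
Proof.
elim: n => [|n IH]; first by rewrite !big_ord0 subrr.
by rewrite !big_ord_recr/= IH /stop_prob; ring.
Qed.

Lemma sum_stop_prob_le1 x : (\sum_(0 <= t <oo) (stop_prob psi x t)%:E <= 1)%E.
Proof.
apply: lime_le.
  by apply: is_cvg_nneseries => t _ _; rewrite lee_fin stop_prob_ge0.
apply: nearW => n; rewrite big_mkord sumEFin lee_fin sum_stop_prob.
rewrite gerBl prodr_ge0// => i _; by rewrite subr_ge0 rule_le1.
Qed.

Lemma mean_run_length_ge0 x : (0 <= mean_run_length psi x)%E.
Proof.
rewrite /mean_run_length adde_ge0//.
  by apply: nneseries_ge0 => t _ _; rewrite lee_fin mulr_ge0// stop_prob_ge0.
by rewrite mule_ge0// sube_ge0 ?sum_stop_prob_le1 ?orbT.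
Qed.

End rule.

Lemma nneseries_succ (f : nat -> \bar R) : (forall n, (0 <= f n)%E) ->
  (\sum_(0 <= n <oo) f n = f 0%N + \sum_(0 <= n <oo) f n.+1)%E.
Proof.
move=> f0; rewrite nneseries_recl//; congr (_ + _)%E.
by rewrite -nneseries_addn//; under eq_eseriesr do rewrite addn1.
Qed.

(** Either T = 0, or T = 1 + T' with T' the run length of the shifted rule. The work lies in
    matching the contributions of infinite run lengths. *)
Lemma mean_run_lengthE psi x : randomized_rule psi ->
  (mean_run_length psi x =
   (1 - psi 0%N [tuple])%:E *
   (1 + mean_run_length (shift_rule (x 0%N) psi) (x \o succn)))%E.
Proof.
move=> rpsi; have rs := randomized_rule_shift (x 0%N) rpsi.
set q := 1 - _; set M' := mean_run_length (shift_rule _ _) _.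
have q0 : 0 <= q by rewrite subr_ge0 rule_le1.
have s0 t : (0 <= (stop_prob (shift_rule (x 0%N) psi) (x \o succn) t)%:E)%E.
  by rewrite lee_fin stop_prob_ge0.
pose S := (\sum_(0 <= t <oo) (stop_prob (shift_rule (x 0%N) psi) (x \o succn) t)%:E)%E.
pose S1 := (\sum_(0 <= t <oo) (t%:R * stop_prob (shift_rule (x 0%N) psi) (x \o succn) t)%:E)%E.
have S0 : (0 <= S)%E by apply: nneseries_ge0.
have S10 : (0 <= S1)%E.
  by apply: nneseries_ge0 => t _ _; rewrite lee_fin mulr_ge0// -lee_fin.
have Sle1 : (S <= 1)%E by exact: sum_stop_prob_le1.
have Sfin : S \is a fin_num by rewrite ge0_fin_numE// (le_lt_trans Sle1)// ltry.
have E1 : (\sum_(0 <= t <oo) (t%:R * stop_prob psi x t)%:E = q%:E * (S1 + S))%E.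
  rewrite nneseries_succ; last first.
    by move=> n; rewrite lee_fin mulr_ge0// stop_prob_ge0.
  rewrite mul0r add0e -nneseriesD//; last first.
    by move=> t _ _; rewrite lee_fin mulr_ge0// -lee_fin.
  rewrite -nneseriesZl; last by move=> t _; rewrite adde_ge0// lee_fin mulr_ge0// -lee_fin.
  apply: eq_eseriesr => t _; rewrite stop_probS -EFinD -EFinM; congr EFin.
  by rewrite -natr1 -/q; ring.
have E2 : (\sum_(0 <= t <oo) (stop_prob psi x t)%:E = (psi 0%N [tuple])%:E + q%:E * S)%E.
  rewrite nneseries_succ; last by move=> n; rewrite lee_fin stop_prob_ge0.
  rewrite stop_prob0; congr (_ + _)%E.
  rewrite -nneseriesZl//; apply: eq_eseriesr => t _.
  by rewrite stop_probS EFinM.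
rewrite /mean_run_length E1 E2 /M' /mean_run_length -/S -/S1.
move: Sfin Sle1 S0; case: (S) => // s _; rewrite !lee_fin => s1 s0'.
have -> : (1 - ((psi 0%N [tuple])%:E + q%:E * s%:E) = (q * (1 - s))%:E)%E.
  by rewrite -EFinM -EFinD; congr (_%:E); rewrite /q; ring.
have -> : (1 - s%:E = (1 - s)%:E)%E by [].
have [q00|q_neq0] := eqVneq q 0; first by rewrite q00 !mul0r mule0 !mul0e adde0.
have qgt0 : 0 < q by rewrite lt_neqAle eq_sym q_neq0.
(* If s = 1 the shifted test stops with probability one and no infinite term remains; otherwise both
   sides are +oo. *)
have [s_1|s_neq1] := eqVneq s 1.
  rewrite s_1 subrr mulr0 !mule0 !adde0 addeC//.
have sgt : 0 < 1 - s by rewrite lt_neqAle subr_ge0 s1 andbT eq_sym subr_eq0 eq_sym.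
rewrite gt0_mulye ?lte_fin ?mulr_gt0// gt0_mulye ?lte_fin//.
have S1Ny : S1 != -oo%E by rewrite gt_eqF// (lt_le_trans _ S10)// ltNyr.
rewrite [in RHS](addey S1Ny) [in RHS]addey// gt0_muley ?lte_fin// addey//.
rewrite gt_eqF// (@lt_le_trans _ _ 0%E)// mule_ge0 ?lee_fin//.
by rewrite adde_ge0// lee_fin.
Qed.

End RunLength.

(** * Expected terminal cost *)

Section Cost.
Context {d dO} {T : measurableType d} {Omega : measurableType dO} {R : realType}.
Variables (X : nat -> {mfun Omega >-> T}) (Q0 Q1 : probability Omega R).
Variables (P0 P1 : probability T R).
Variables (mu : {measure set T -> \bar R}) (p0 p1 : T -> R).
Variable tie : forall t, t.-tuple T -> R.
Hypotheses (iid0 : iid Q0 X P0) (iid1 : iid Q1 X P1).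
Hypotheses (density0 : is_density mu P0 p0) (density1 : is_density mu P1 p1).
Hypothesis P1_ac_P0 : P1 `<< P0.
Hypothesis tie_rule : randomized_rule tie.

Local Notation lr := (lr p0 p1).
Local Notation law0 t := (distribution Q0 (historyRV X t)).
Local Notation law1 t := (distribution Q1 (historyRV X t)).

Definition lrprod t (xs : t.-tuple T) : R := \prod_(x <- xs) lr x.

Lemma lrprod_cons t x (xs : t.-tuple T) :
  lrprod (cons_tuple x xs) = lr x * lrprod xs.
Proof. by rewrite /lrprod big_cons. Qed.

Lemma lrprod_ge0 t (xs : t.-tuple T) : 0 <= lrprod xs.
Proof. by apply: prodr_ge0 => x _; exact: lr_ge0 density0 density1 _. Qed.

Lemma measurable_lrprod t : measurable_fun setT (@lrprod t).
Proof.
rewrite /lrprod; under eq_fun do rewrite big_tuple.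
apply: measurable_prod => i _.
exact: (measurableT_comp (measurable_lr density0 density1) (measurable_tnth _)).
Qed.

(** Change of measure: the factors [lr] are gathered one observation at a time. *)
Lemma integral_history_lr t (F : t.-tuple T -> \bar R) :
  measurable_fun setT F -> (forall xs, 0 <= F xs)%E ->
  (\int[law1 t]_xs F xs = \int[law0 t]_xs (F xs * (lrprod xs)%:E))%E.
Proof.
elim: t F => [|t IH] F mF F0.
  rewrite (ge0_integral_history0 _ _ mF F0) ge0_integral_history0//.
  - by rewrite /lrprod big_nil mule1.
  - by apply: emeasurable_funM => //; apply/measurable_EFinP; exact: measurable_lrprod.
  - by move=> xs; rewrite mule_ge0// lee_fin lrprod_ge0.
have mFL : measurable_fun setT (fun xs : t.+1.-tuple T => F xs * (lrprod xs)%:E)%E.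
  by apply: emeasurable_funM => //; apply/measurable_EFinP; exact: measurable_lrprod.
have FL0 (xs : t.+1.-tuple T) : (0 <= F xs * (lrprod xs)%:E)%E.
  by rewrite mule_ge0// lee_fin lrprod_ge0.
rewrite (ge0_integral_historyS iid1 mF F0) (ge0_integral_historyS iid0 mFL FL0).
have mcons x : measurable_fun setT (fun xs : t.-tuple T => cons_tuple x xs).
  exact: measurable_cons.
have mFx x : measurable_fun setT (fun xs : t.-tuple T => F (cons_tuple x xs)).
  exact: measurableT_comp mF (mcons x).
under eq_integral do rewrite IH//.
rewrite (ge0_integral_density (measurable_lr density0 density1)
  (lr_ge0 density0 density1) (lr_density density0 density1 P1_ac_P0)); last 2 first.
(* [measurable_integral_history] takes a function of the whole tuple, so the likelihood ratio of the
   tail is expressed through [behead]. *)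
- have mG : measurable_fun setT (fun xs : t.+1.-tuple T =>
      F xs * (lrprod [tuple of behead xs])%:E)%E.
    apply: emeasurable_funM => //; apply/measurable_EFinP.
    by apply: (measurableT_comp (@measurable_lrprod t)); exact: measurable_behead.
  rewrite (_ : (fun x => _) = fun x => (\int[law0 t]_xs
      (F (cons_tuple x xs) * (lrprod [tuple of behead (cons_tuple x xs)])%:E))%E).
    apply: (measurable_integral_history _ _ mG) => xs.
    by rewrite mule_ge0// lee_fin lrprod_ge0.
  apply/funext => x; apply: eq_integral => xs _; congr (_ * (lrprod _)%:E)%E.
  exact/val_inj.
- by move=> x; apply: integral_ge0 => xs _; rewrite mule_ge0// lee_fin lrprod_ge0.
apply: eq_integral => x _; rewrite -ge0_integralZr//.
- apply: eq_integral => xs _; rewrite lrprod_cons EFinM -muleA.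
  by congr (_ * _)%E; rewrite muleC.
- by apply: emeasurable_funM => //; apply/measurable_EFinP; exact: measurable_lrprod.
- by move=> xs _; rewrite mule_ge0// lee_fin lrprod_ge0.
- by rewrite lee_fin; exact: lr_ge0 density0 density1 _.
Qed.

(** [stop_prob] reads an infinite sequence, but at time t only its first t entries; padding with
    [point] turns it into a function of the history, to be integrated against its law. *)
Definition tstop (psi : forall t, t.-tuple T -> R) t (xs : t.-tuple T) : R :=
  stop_prob psi (nth point xs) t.

Lemma history_nth (x : nat -> T) t n : (n <= t)%N ->
  history (nth point (history x t)) n = history x n.
Proof.
move=> nt; apply: eq_from_tnth => i; rewrite !tnth_mktuple.
have it : (i < t)%N by exact: leq_trans (ltn_ord i) nt.
by rewrite -(tnth_nth _ _ (Ordinal it)) tnth_mktuple.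
Qed.

Lemma tstop_history psi x t : tstop psi (history x t) = stop_prob psi x t.
Proof.
rewrite /tstop /stop_prob history_nth//; congr (_ * _).
by apply: eq_bigr => i _; rewrite history_nth// ltnW.
Qed.

Lemma tstop_nil psi (xs : 0.-tuple T) : tstop psi xs = psi 0%N [tuple].
Proof. exact: stop_prob0. Qed.

Lemma tstop_cons psi t x (xs : t.-tuple T) :
  tstop psi (cons_tuple x xs) = (1 - psi 0%N [tuple]) * tstop (shift_rule x psi) xs.
Proof. exact: stop_probS. Qed.

Lemma measurable_tstop psi t :
  randomized_rule psi -> measurable_fun setT (@tstop psi t).
Proof.
move=> rpsi.
have mh n : measurable_fun setT (fun xs : t.-tuple T => history (nth point xs) n).
  apply/measurable_fun_tnthP => i.
  have [it|ti] := ltnP i t.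
    rewrite (_ : _ \o _ = (@tnth t T)^~ (Ordinal it)); first exact: measurable_tnth.
    by apply/funext => xs /=; rewrite tnth_mktuple (tnth_nth point).
  rewrite (_ : _ \o _ = fun=> point)//.
  by apply/funext => xs /=; rewrite tnth_mktuple nth_default// size_tuple.
apply: measurable_funM.
  by apply: (measurableT_comp (rpsi t).1); exact: mh.
apply: measurable_prod => i _; apply: measurable_funB => //.
by apply: (measurableT_comp (rpsi i).1); exact: mh.
Qed.

Lemma tstop_ge0 psi t (xs : t.-tuple T) : randomized_rule psi -> 0 <= tstop psi xs.
Proof. by move=> rpsi; exact: stop_prob_ge0. Qed.

Lemma g_ge0 (z : R) : 0 <= z -> 0 <= g z.
Proof. by move=> z0; rewrite /g le_min ler01. Qed.

Lemma measurable_g : measurable_fun setT (@g R).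
Proof. exact: measurable_minr. Qed.

(** The expectation of g(z L_T) under H_0, split by the value of T. It lives in the extended reals,
    so that one-step equations need no summability. *)
Definition cost psi z : \bar R :=
  (\sum_(0 <= t <oo) \int[law0 t]_xs (tstop psi xs * g (z * lrprod xs))%:E)%E.

Section step.
Variables (psi : forall t, t.-tuple T -> R) (z : R).
Hypotheses (rpsi : randomized_rule psi) (z0 : 0 <= z).

Lemma measurable_cost_term t :
  measurable_fun setT
    (fun xs : t.-tuple T => (tstop psi xs * g (z * lrprod xs))%:E).
Proof.
apply/measurable_EFinP; apply: measurable_funM; first exact: measurable_tstop.
apply: (measurableT_comp measurable_g); apply: measurable_funM => //.
exact: measurable_lrprod.
Qed.

Lemma cost_term_ge0 t (xs : t.-tuple T) :
  (0 <= (tstop psi xs * g (z * lrprod xs))%:E)%E.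
Proof.
by rewrite lee_fin mulr_ge0 ?tstop_ge0// g_ge0// mulr_ge0// lrprod_ge0.
Qed.

Lemma cost_ge0 : (0 <= cost psi z)%E.
Proof.
apply: nneseries_ge0 => t _ _.
by apply: integral_ge0 => xs _; exact: cost_term_ge0.
Qed.

End step.

Lemma cost_tail_term psi (z : R) t x : randomized_rule psi -> 0 <= z ->
  (\int[law0 t]_xs (tstop psi (cons_tuple x xs) *
     g (z * lrprod (cons_tuple x xs)))%:E =
   (1 - psi 0%N [tuple])%:E *
   \int[law0 t]_xs (tstop (shift_rule x psi) xs * g (z * lr x * lrprod xs))%:E)%E.
Proof.
move=> rpsi z0.
have zlr : 0 <= z * lr x by rewrite mulr_ge0//; exact: lr_ge0 density0 density1 _.
rewrite -ge0_integralZl//.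
- by apply: eq_integral => xs _; rewrite tstop_cons lrprod_cons -EFinM !mulrA.
- by apply: measurable_cost_term; exact: randomized_rule_shift.
- by move=> xs _; apply: cost_term_ge0 => //; exact: randomized_rule_shift.
- by rewrite lee_fin subr_ge0 rule_le1.
Qed.

(** Measurability in x is read off the terms of [psi] itself, which are jointly measurable, after
    division by 1 - psi_0; hence the condition psi_0 < 1. *)
Lemma measurable_cost_shift psi (z : R) : randomized_rule psi -> 0 <= z ->
  psi 0%N [tuple] < 1 ->
  measurable_fun setT (fun x => cost (shift_rule x psi) (z * lr x)).
Proof.
move=> rpsi z0 psi1; apply: ge0_emeasurable_sum => [t x _ _|t _].
  apply: integral_ge0 => xs _; apply: cost_term_ge0.
    exact: randomized_rule_shift.
  by rewrite mulr_ge0//; exact: lr_ge0 density0 density1 _.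
have q0 : 0 < 1 - psi 0%N [tuple] by rewrite subr_gt0.
rewrite (_ : (fun x => _) = fun x => (((1 - psi 0%N [tuple])^-1)%:E *
  \int[law0 t]_xs (tstop psi (cons_tuple x xs) *
     g (z * lrprod (cons_tuple x xs)))%:E)%E); last first.
  apply/funext => x; rewrite cost_tail_term// muleA -EFinM mulVf ?gt_eqF//.
  by rewrite mul1e.
apply: emeasurable_funM => //.
apply: (measurable_integral_history Q0 X (@measurable_cost_term _ z rpsi t.+1)) => xs.
exact: cost_term_ge0.
Qed.

Lemma cost_step psi (z : R) : randomized_rule psi -> 0 <= z ->
  psi 0%N [tuple] < 1 ->
  cost psi z = ((psi 0%N [tuple] * g z)%:E +
    (1 - psi 0%N [tuple])%:E * \int[P0]_x cost (shift_rule x psi) (z * lr x))%E.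
Proof.
move=> rpsi z0 psi1; rewrite /cost nneseries_succ; last first.
  by move=> t; apply: integral_ge0 => xs _; exact: cost_term_ge0.
have zlr x : 0 <= z * lr x by rewrite mulr_ge0//; exact: lr_ge0 density0 density1 _.
have q0 : 0 < 1 - psi 0%N [tuple] by rewrite subr_gt0.
congr (_ + _)%E.
  rewrite ge0_integral_history0.
  - by rewrite tstop_nil /lrprod big_nil mulr1.
  - exact: measurable_cost_term.
  - by move=> xs; exact: cost_term_ge0.
have mI t : measurable_fun setT (fun x => \int[law0 t]_xs
    (tstop psi (cons_tuple x xs) * g (z * lrprod (cons_tuple x xs)))%:E)%E.
  apply: (measurable_integral_history Q0 X (@measurable_cost_term _ z rpsi t.+1)) => xs.
  exact: cost_term_ge0.
rewrite -ge0_integralZl//; first last.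
- by rewrite lee_fin ltW.
- move=> x _; apply: cost_ge0 => //; exact: randomized_rule_shift.
- exact: measurable_cost_shift.
transitivity (\int[P0]_x \sum_(0 <= t <oo) \int[law0 t]_xs
    (tstop psi (cons_tuple x xs) * g (z * lrprod (cons_tuple x xs)))%:E)%E;
    last first.
  apply: eq_integral => x _; rewrite -nneseriesZl.
    by apply: eq_eseriesr => t _; rewrite cost_tail_term.
  move=> t _; apply: integral_ge0 => xs _.
  by apply: cost_term_ge0 => //; exact: randomized_rule_shift.
rewrite integral_nneseries//; last first.
  by move=> t x _; apply: integral_ge0 => xs _; exact: cost_term_ge0.
apply: eq_eseriesr => t _; rewrite (ge0_integral_historyS iid0)//.
- exact: measurable_cost_term.
- by move=> xs; exact: cost_term_ge0.
Qed.

Lemma cost_stop psi (z : R) : randomized_rule psi -> 0 <= z ->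
  psi 0%N [tuple] = 1 -> cost psi z = (g z)%:E.
Proof.
move=> rpsi z0 psi1; rewrite /cost nneseries_succ; last first.
  by move=> t; apply: integral_ge0 => xs _; exact: cost_term_ge0.
rewrite ge0_integral_history0; last 2 first.
- exact: measurable_cost_term.
- by move=> xs; exact: cost_term_ge0.
rewrite tstop_nil psi1 /lrprod big_nil mulr1 mul1r eseries0 ?adde0// => t _ _.
apply: integral0_eq => xs _.
rewrite (tuple_eta xs).
by rewrite (_ : [tuple of _] = cons_tuple (thead xs) [tuple of behead xs])
  // tstop_cons psi1 subrr !mul0r.
Qed.

Local Notation D1 z := (decide1 p0 p1 tie z).

Lemma decide1_itv (z : R) t (xs : t.-tuple T) : 0 <= D1 z xs <= 1.
Proof.
rewrite /decide1; case: ifP => _; first by rewrite ler01 lexx.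
by case: ifP => _; [rewrite ler01 lexx|apply: (tie_rule t).2].
Qed.

Lemma measurable_decide1 (z : R) t :
  measurable_fun setT (fun xs : t.-tuple T => D1 z xs).
Proof.
have ml : measurable_fun setT (fun xs : t.-tuple T => z * lrprod xs).
  by apply: measurable_funM => //; exact: measurable_lrprod.
apply: measurable_fun_ifT => //; first exact: measurable_fun_ltr.
by apply: measurable_fun_ifT => //; [exact: measurable_fun_ltr|apply: (tie_rule t).1].
Qed.

(** The decision incurs the smaller of the weighted errors 1 and l = z L_t; at l = 1 they agree, so
    every tie rule gives the same total. *)
Lemma g_decide1 (z : R) t (xs : t.-tuple T) :
  g (z * lrprod xs) = D1 z xs + z * (lrprod xs * (1 - D1 z xs)).
Proof.
rewrite /decide1 -/(lrprod xs) mulrA /g.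
case: ltgtP => [l1|l1|<-]; rewrite ?subrr ?subr0 ?mulr0 ?mulr1 ?addr0 ?add0r//.
by rewrite mul1r addrC subrK.
Qed.

Section errors.
Variables (psi : forall t, t.-tuple T -> R) (z : R).
Hypotheses (rpsi : randomized_rule psi) (z0 : 0 <= z).

(** Common form of the sums in [alpha] and [beta], with [h] the probability of the wrong
    decision. *)
Let err (Q : probability Omega R) (h : forall t, t.-tuple T -> R) : \bar R :=
  (\sum_(0 <= t <oo) 'E_Q[fun w =>
     (stop_prob psi (obs X w) t * h t (history (obs X w) t))%R])%E.

Implicit Types (Q : probability Omega R) (h : forall t, t.-tuple T -> R).

Let errE Q h : (forall t, measurable_fun setT (h t)) ->
  (forall t xs, 0 <= h t xs) ->
  (err Q h = \sum_(0 <= t <oo) \int[distribution Q (historyRV X t)]_xs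
     (tstop psi xs * h t xs)%:E)%E.
Proof.
move=> mh h0; apply: eq_eseriesr => t _; rewrite unlock.
rewrite ge0_integral_distribution.
- by apply: eq_integral => w _ /=; rewrite tstop_history.
- apply/measurable_EFinP; apply: measurable_funM.
    exact: measurable_tstop.
  exact: mh.
- by move=> xs; rewrite lee_fin mulr_ge0 ?tstop_ge0.
Qed.

Let err_ge0 Q h : (forall t xs, 0 <= h t xs) -> (0 <= err Q h)%E.
Proof.
move=> h0; apply: nneseries_ge0 => t _ _; apply: expectation_ge0 => w.
by rewrite mulr_ge0 ?stop_prob_ge0.
Qed.

Let measurable_stop_prob t :
  measurable_fun setT (fun w => stop_prob psi (obs X w) t).
Proof.
rewrite (_ : (fun _ => _) = @tstop psi t \o historyRV X t).
  by apply: measurableT_comp => //; exact: measurable_tstop.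
by apply/funext => w /=; rewrite tstop_history.
Qed.

(** Makes the sums finite, so that [fine] in [alpha] and [beta] loses nothing. *)
Let err_le1 Q h : (forall t, measurable_fun setT (h t)) ->
  (forall t xs, 0 <= h t xs <= 1) -> (err Q h <= 1)%E.
Proof.
move=> mh h01.
have h0 t xs : 0 <= h t xs by case/andP: (h01 t xs).
apply: (@le_trans _ _ (\sum_(0 <= t <oo) \int[Q]_w (stop_prob psi (obs X w) t)%:E)%E).
  apply: lee_nneseries => [t _ _|t _].
    by apply: expectation_ge0 => w; rewrite mulr_ge0 ?stop_prob_ge0.
  rewrite unlock; apply: ge0_le_integral => //.
  - by move=> w _; rewrite lee_fin mulr_ge0 ?stop_prob_ge0.
  - apply/measurable_EFinP; apply: measurable_funM.
      exact: measurable_stop_prob.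
    by apply: (measurableT_comp (mh t)); exact: measurable_history.
  - by apply/measurable_EFinP.
  - move=> w _; rewrite lee_fin ler_piMr ?stop_prob_ge0//.
    by case/andP: (h01 t (history (obs X w) t)).
rewrite -integral_nneseries//; last 2 first.
- by move=> t; apply/measurable_EFinP.
- by move=> t w _; rewrite lee_fin stop_prob_ge0.
rewrite -(probability_setT Q) -[leRHS]mul1e -(integral_cst Q measurableT 1%E).
apply: ge0_le_integral => //.
- by move=> w _; apply: nneseries_ge0 => t _ _; rewrite lee_fin stop_prob_ge0.
- apply: ge0_emeasurable_sum => [t w _ _|t _]; first by rewrite lee_fin stop_prob_ge0.
  exact/measurable_EFinP.
- by move=> w _; exact: sum_stop_prob_le1.
Qed.

(** The Type II sum is carried over to H_0 by the change of measure; then [g_decide1] applies term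
    by term. *)
Lemma alpha_beta_cost :
  (cost psi z = (alpha Q0 X p0 p1 tie psi z + z * beta Q1 X p0 p1 tie psi z)%:E)%E.
Proof.
have d0 t (xs : t.-tuple T) : 0 <= D1 z xs by case/andP: (decide1_itv z xs).
have d1 t (xs : t.-tuple T) : 0 <= 1 - D1 z xs.
  by rewrite subr_ge0; case/andP: (decide1_itv z xs).
have d1' t (xs : t.-tuple T) : 0 <= 1 - D1 z xs <= 1.
  by rewrite d1 gerBl d0.
have md t : measurable_fun setT (fun xs : t.-tuple T => D1 z xs).
  exact: measurable_decide1.
have md1 t : measurable_fun setT (fun xs : t.-tuple T => 1 - D1 z xs).
  by apply: measurable_funB; [exact: measurable_cst|exact: md].
rewrite EFinD EFinM /alpha /beta.
pose a := err Q0 (fun t xs => D1 z xs).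
pose b := err Q1 (fun t xs => 1 - D1 z xs).
have afin : a \is a fin_num.
  rewrite ge0_fin_numE ?err_ge0//; apply: le_lt_trans (err_le1 _ _ _) _ => //.
    by move=> t xs; exact: decide1_itv.
  exact: ltry.
have bfin : b \is a fin_num.
  rewrite ge0_fin_numE ?err_ge0//; apply: le_lt_trans (err_le1 _ _ _) _ => //.
  exact: ltry.
rewrite (fineK afin) (fineK bfin) /a /b.
rewrite !errE// -nneseriesZl; last first.
  by move=> t _; apply: integral_ge0 => xs _; rewrite lee_fin mulr_ge0 ?tstop_ge0.
rewrite -nneseriesD; last 2 first.
- by move=> t _ _; apply: integral_ge0 => xs _; rewrite lee_fin mulr_ge0 ?tstop_ge0.
- move=> t _ _; rewrite mule_ge0//; apply: integral_ge0 => xs _.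
  by rewrite lee_fin mulr_ge0 ?tstop_ge0.
apply: eq_eseriesr => t _.
have mt := measurable_tstop (t := t) rpsi.
have m0 : measurable_fun setT (fun xs : t.-tuple T => (tstop psi xs * D1 z xs)%:E).
  by apply/measurable_EFinP; apply: measurable_funM; [exact: mt|exact: md].
have m1 : measurable_fun setT
    (fun xs : t.-tuple T => (tstop psi xs * (1 - D1 z xs))%:E).
  by apply/measurable_EFinP; apply: measurable_funM; [exact: mt|exact: md1].
have m2 : measurable_fun setT (fun xs : t.-tuple T =>
    (tstop psi xs * (1 - D1 z xs))%:E * (lrprod xs)%:E)%E.
  by apply: emeasurable_funM => //; apply/measurable_EFinP; exact: measurable_lrprod.
have p0' (xs : t.-tuple T) : (0 <= (tstop psi xs * D1 z xs)%:E)%E.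
  by rewrite lee_fin mulr_ge0 ?tstop_ge0.
have p1' (xs : t.-tuple T) : (0 <= (tstop psi xs * (1 - D1 z xs))%:E)%E.
  by rewrite lee_fin mulr_ge0 ?tstop_ge0.
have p2' (xs : t.-tuple T) :
    (0 <= (tstop psi xs * (1 - D1 z xs))%:E * (lrprod xs)%:E)%E.
  by rewrite mule_ge0// lee_fin lrprod_ge0.
rewrite integral_history_lr// -ge0_integralZl ?lee_fin// -ge0_integralD//.
- by apply: eq_integral => xs _; rewrite g_decide1 -!EFinM -EFinD; congr (_%:E); ring.
- by move=> xs _; apply: mule_ge0.
- exact: measurable_funeM.
Qed.

End errors.

End Cost.

(** * Maximizing a ratio *)

Section RatioArgmax.
Context {R : realType}.
(** Applied to N b = g z - cont_value k z b. Being nondecreasing and right-continuous, N is upper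
    semicontinuous, and N b / b tends to 0; hence a maximum exists although N may jump up at
    integers. *)
Variables (N : R -> R) (m : R).
Hypotheses (m1 : 1 <= m) (N01 : forall b, 1 <= b -> 0 <= N b <= 1).
Hypothesis N_nd : forall b b', 1 <= b -> b <= b' -> N b <= N b'.
Hypothesis N_rc : forall b b', 1 <= b -> b <= b' ->
  Num.truncn b = Num.truncn b' -> N b' <= N b + (b' - b).

Implicit Types a b e : R.

Let ratio b := N b / b.
Let E := [set ratio b | b in `[m, +oo[].
Let S := sup E.

Let ge1_gt0 b : 1 <= b -> 0 < b. Proof. exact: lt_le_trans. Qed.

Let ratio_le b : 1 <= b -> ratio b <= b^-1.
Proof.
move=> b1; have /andP[N0 N1] := N01 b1; rewrite ler_pdivrMr ?ge1_gt0//.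
by rewrite mulVf// gt_eqF// ge1_gt0.
Qed.

Let supE : has_sup E.
Proof.
split; first by exists (ratio m), m => //=; rewrite in_itv/= lexx.
exists 1 => _ [b mb <-]; move: mb; rewrite /= in_itv/= andbT => mb.
have b1 := le_trans m1 mb.
by rewrite (le_trans (ratio_le b1))// invf_le1// ge1_gt0.
Qed.

Let leS b : m <= b -> ratio b <= S.
Proof.
move=> mb; apply: (sup_upper_bound supE).
by exists b => //=; rewrite in_itv/= andbT.
Qed.

Let S_adh e : 0 < e -> exists2 b, m <= b & S - e < ratio b.
Proof.
move=> e0; have [_ [b /= + <-] Sb] := sup_adherent e0 supE.
by rewrite in_itv/= andbT => mb; exists b.
Qed.

(* The supremum of the [b] such that [N b' / b'] stays away from its supremum
   on [m, b] is the leftmost maximizer: near it there are near-maximizers, and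
   monotonicity and right-continuity of [N] carry these over to the point. *)
Lemma ratio_argmax : exists b,
  [/\ m <= b, forall b', m <= b' -> ratio b' <= ratio b &
      forall a, m <= a -> a < b ->
        exists2 e, 0 < e & forall b', m <= b' -> b' <= a -> ratio b' <= ratio b - e].
Proof.
pose L := [set b | m <= b /\ exists2 e, 0 < e &
  forall b', m <= b' -> b' <= b -> ratio b' <= S - e].
have S0 : 0 <= S.
  have /andP[N0 _] := N01 m1; apply: le_trans (leS (lexx m)).
  by rewrite divr_ge0// ltW// ge1_gt0.
have notL b : m <= b -> ~ L b -> forall e, 0 < e ->
    exists b', [/\ m <= b', b' <= b & S - e < ratio b'].
  move=> mb nLb e e0; apply: contrapT => nex; apply: nLb; split => //.
  exists e => // b' mb' bb'; rewrite leNgt; apply/negP => h; apply: nex.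
  by exists b'.
have [L0|L0] := pselect (L !=set0); last first.
  (* As m is not in [L], near-maximizers exist in the degenerate interval [m, m]. *)
  exists m; split => //.
    move=> b mb; apply: le_trans (leS mb) _; apply/ler_addgt0Pr => e e0.
    have [|b' [mb' b'm h]] := notL m (lexx m) _ e e0.
      by move=> Lm; apply: L0; exists m.
    have <- : b' = m by apply/eqP; rewrite eq_le b'm.
    by rewrite -lerBlDr ltW.
  by move=> a ma am; have := le_lt_trans ma am; rewrite ltxx.
have [S00|Sn0] := eqVneq S 0.
  exfalso; have [l [ml [e e0 /(_ m (lexx m) ml)]]] := L0.
  have /andP[N0 _] := N01 m1.
  have : 0 <= ratio m by rewrite divr_ge0// ltW// ge1_gt0.
  by move: e0; rewrite S00; lra.
have Sgt0 : 0 < S by rewrite lt_neqAle eq_sym Sn0.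
have Lub : has_ubound L.
  (* Beyond 2 / S the ratio is at most S / 2, so near-maximizers lie to the left of it; this bounds
     [L]. *)
  exists (m + 2 / S) => b [mb [e e0 h]]; rewrite leNgt; apply/negP => lb.
  have [b' mb' hb'] := S_adh (e := Num.min e (S / 2)) ltac:(by rewrite lt_min e0 divr_gt0).
  have [b'b|bb'] := leP b' b.
    have := h _ mb' b'b; have : Num.min e (S / 2) <= e by rewrite ge_min lexx.
    by move: hb'; lra.
  have b'1 := le_trans m1 mb'.
  have rS : ratio b' <= S / 2.
    apply: le_trans (ratio_le b'1) _.
    have b'0 := ge1_gt0 b'1; have m0 := ge1_gt0 m1.
    have Sb' : 2 / S <= b' by move: bb' lb; lra.
    rewrite -div1r ler_pdivrMr// mulrAC ler_pdivlMr// mul1r mulrC.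
    by rewrite -ler_pdivrMr.
  have mS : Num.min e (S / 2) <= S / 2 by rewrite ge_min lexx orbT.
  by move: hb' mS rS; lra.
pose be := sup L.
have supL : has_sup L by [].
have [l0 Ll0] := L0.
have mbe : m <= be by apply: le_trans Ll0.1 _; exact: sup_upper_bound.
have be1 := le_trans m1 mbe.
have be0 : 0 < be by exact: ge1_gt0.
have be_max : S <= ratio be.
  rewrite ler_pdivlMr// leNgt; apply/negP => lt.
  have /andP[tb1 tb2] := truncn_itv (ltW be0).
  pose gap := S * be - N be.
  have gap0 : 0 < gap by rewrite subr_gt0.
  (* [t] keeps be + t below the next integer, where [N_rc] applies, and keeps the accumulated
     errors, at most t (be + 3), within [gap]. *)
  pose t := Num.min (Num.min (gap / (2 * (be + 2))) (((Num.truncn be).+1%:R - be) / 2)) 1.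
  have t0 : 0 < t.
    rewrite !lt_min ltr01 andbT; apply/andP; split; apply: divr_gt0 => //.
      by rewrite mulr_gt0// addr_gt0.
    by rewrite subr_gt0.
  have tgap : t * (2 * (be + 2)) <= gap.
    rewrite -ler_pdivlMr ?mulr_gt0 ?addr_gt0//.
    by rewrite /t !ge_min lexx.
  have tt : t <= ((Num.truncn be).+1%:R - be) / 2 by rewrite /t !ge_min lexx orbT.
  have t1 : t <= 1 by rewrite /t ge_min lexx orbT.
  have [l Ll lbe] := sup_adherent t0 supL; rewrite -/be in lbe.
  have [ml [el el0 hl]] := Ll.
  have nLb : ~ L (be + t).
    by move=> /(sup_upper_bound supL); rewrite -/be; move: t0; lra.
  have mbet : m <= be + t by move: mbe t0; lra.
  have elt0 : 0 < Num.min el t by rewrite lt_min el0.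
  have [b' [mb' b'bt hb']] := notL _ mbet nLb _ elt0.
  have mine : Num.min el t <= el by rewrite ge_min lexx.
  have mint : Num.min el t <= t by rewrite ge_min lexx orbT.
  have b'l : l < b'.
    rewrite ltNge; apply/negP => b'l; have := hl _ mb' b'l.
    by move: hb' mine; lra.
  have b'1 := le_trans m1 mb'.
  have Nb' : N b' <= N be + t.
    apply: (@le_trans _ _ (N (be + t))); first exact: N_nd.
    apply: (@le_trans _ _ (N be + (be + t - be))); last by lra.
    apply: N_rc => //; first by move: t0; lra.
    apply/esym/truncn_def; apply/andP; split; first by move: tb1 t0; lra.
    by move: tt tb2; lra.
  have S1 : S <= 1.
    apply: ge_sup; first by case: supE.
    move=> _ [b mb <-]; move: mb; rewrite /= in_itv/= andbT => mb.
    have b1 := le_trans m1 mb.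
    by rewrite (le_trans (ratio_le b1))// invf_le1// ge1_gt0.
  have : (S - t) * b' < N b'.
    rewrite -ltr_pdivlMr ?ge1_gt0//; apply: le_lt_trans hb'.
    by move: mint; lra.
  have : S * t <= t by rewrite ger_pMl.
  have : t * b' <= t * (be + 1) by rewrite ler_pM2l//; move: b'bt t1; lra.
  have : S * (be - t) <= S * b'.
    by rewrite ler_pM2l// ltW// (lt_trans lbe).
  move: Nb' tgap; rewrite /gap; nra.
have Sbe : S = ratio be by apply/eqP; rewrite eq_le be_max leS.
exists be; split => //; first by move=> b' mb'; rewrite -Sbe leS.
move=> a ma abe.
have [l [ml [e e0 hl]] lbe] := sup_adherent (eps := be - a) ltac:(by rewrite subr_gt0) supL.
exists e => // b' mb' b'a; rewrite -Sbe; apply: hl => //.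
by apply: le_trans b'a _; move: lbe; rewrite -/be; lra.
Qed.

End RatioArgmax.

(** * Averaging over one observation *)

Section Average.
Context {d} {T : measurableType d} {R : realType}.
Variables (P : probability T R) (lr : T -> R).
Hypotheses (lr0 : forall x, 0 <= lr x) (mlr : measurable_fun setT lr).
Hypothesis int_lr : (\int[P]_x (lr x)%:E = 1)%E.
Implicit Types (h : R -> R) (z c b : R).

Definition avg h z : R := fine 'E_P[fun x => h (z * lr x)].

(** Monotonicity supplies measurability and the bound by [g] integrability; both properties survive
    averaging over an observation. *)
Definition risk_fun h := (forall z, 0 <= z -> 0 <= h z <= g z) /\
  (forall z z', 0 <= z -> z <= z' -> h z <= h z').

Lemma measurable_nonneg_mono h :
  (forall z z', 0 <= z -> z <= z' -> h z <= h z') ->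
  measurable_fun (`[0, +oo[ : set R) h.
Proof.
move=> hm; apply: (eq_measurable_fun (fun z => h (Num.max 0 z))).
  move=> z; rewrite inE/= in_itv/= andbT => z0.
  by rewrite (max_idPr z0).
apply: nondecreasing_measurable => //= z z' zz'; apply: hm.
  by rewrite le_max lexx.
by rewrite ge_max le_max lexx/= le_max zz' orbT.
Qed.

Let zlr z x : 0 <= z -> 0 <= z * lr x. Proof. by move=> z0; exact: mulr_ge0. Qed.

Lemma measurable_risk_lr h z : 0 <= z -> risk_fun h ->
  measurable_fun setT (fun x => h (z * lr x)).
Proof.
move=> z0 [_ hm].
have mh := measurable_nonneg_mono hm.
have mF : measurable (`[0, +oo[ : set R) by [].
have mz : measurable_fun setT (fun x => z * lr x) by exact: measurable_funM.
have sub : (fun x => z * lr x) @` setT `<=` (`[0, +oo[ : set R).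
  by move=> _ [x _ <-] /=; rewrite in_itv/= andbT zlr.
exact: (measurable_comp mF sub mh mz).
Qed.

Lemma g_le1 z : g z <= 1. Proof. by rewrite /g ge_min lexx. Qed.

Lemma g_lez z : g z <= z. Proof. by rewrite /g ge_min lexx orbT. Qed.

Lemma risk_fun_g : risk_fun (@g R).
Proof.
split=> [z z0|z z' z0 zz']; first by rewrite g_ge0// lexx.
by rewrite /g le_min ge_min lexx/= ge_min zz' orbT.
Qed.

Let risk_itv h z x : 0 <= z -> risk_fun h -> 0 <= h (z * lr x) <= 1.
Proof.
move=> z0 [h01 _]; have /andP[-> /le_trans->//] := h01 _ (zlr x z0).
exact: g_le1.
Qed.

Lemma integrable_risk_lr h z : 0 <= z -> risk_fun h ->
  P.-integrable setT (EFin \o (fun x => h (z * lr x))).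
Proof.
move=> z0 rh; apply: measurable_bounded_integrable => //.
- by rewrite -ge0_fin_numE//; exact: fin_num_measure.
- exact: measurable_risk_lr.
- exists 1; split => // M M1 x _ /=.
  have /andP[h0 h1] := risk_itv x z0 rh.
  by rewrite ger0_norm// (le_trans h1)// ltW.
Qed.

Lemma avgE h z : avg h z = \int[P]_x h (z * lr x).
Proof. by rewrite /avg unlock. Qed.

Let Rcst (r : R) : \int[P]_x r = r.
Proof.
rewrite Rintegral_cst// [fine _](_ : _ = 1) ?mulr1//.
by rewrite -[RHS]/(fine 1%E); congr fine; exact: (@probability_setT _ _ _ P).
Qed.

(** A single inequality for three uses: comparison, Lipschitz bounds (through [e]) and mixtures of
    two budgets (through [w1], [w2]). *)
Lemma avg_le_lin h h1 h2 (w1 w2 e : R) z : 0 <= z ->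
  risk_fun h -> risk_fun h1 -> risk_fun h2 ->
  (forall y, 0 <= y -> h y <= w1 * h1 y + w2 * h2 y + e) ->
  avg h z <= w1 * avg h1 z + w2 * avg h2 z + e.
Proof.
move=> z0 rh rh1 rh2 hle; rewrite !avgE.
have i0 := integrable_risk_lr z0 rh.
have i1 := integrable_risk_lr z0 rh1.
have i2 := integrable_risk_lr z0 rh2.
have ie : P.-integrable setT (EFin \o (fun=> e)).
  by apply: finite_measure_integrable_cst.
have i1' : P.-integrable setT (EFin \o (fun x => w1 * h1 (z * lr x))).
  by exact: (integrableZl measurableT w1 i1).
have i2' : P.-integrable setT (EFin \o (fun x => w2 * h2 (z * lr x))).
  by exact: (integrableZl measurableT w2 i2).
have i12 : P.-integrable setT (EFin \o (fun x => w1 * h1 (z * lr x) + w2 * h2 (z * lr x))).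
  by exact: (integrableD measurableT i1' i2').
rewrite -!RintegralZl// -RintegralD//.
have -> : e = \int[P]_x e by rewrite Rcst.
rewrite -RintegralD//; apply: le_Rintegral => //.
  by exact: (integrableD measurableT i12 ie).
by move=> x _; apply: hle; exact: zlr.
Qed.

Lemma avg_le h h1 z : 0 <= z -> risk_fun h -> risk_fun h1 ->
  (forall y, 0 <= y -> h y <= h1 y) -> avg h z <= avg h1 z.
Proof.
move=> z0 rh rh1 hle; have := @avg_le_lin h h1 h1 1 0 0 z z0 rh rh1 rh1.
rewrite mul1r mul0r !addr0; apply => y y0.
by rewrite mul1r mul0r !addr0 hle.
Qed.

Lemma avg_ge0 h z : 0 <= z -> risk_fun h -> 0 <= avg h z.
Proof.
move=> z0 rh; rewrite avgE; apply: Rintegral_ge0 => x _.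
by case/andP: (risk_itv x z0 rh).
Qed.

(** Jensen's inequality for the concave [g], as [lr] has mean 1. *)
Lemma avg_g_le z : 0 <= z -> avg (@g R) z <= g z.
Proof.
move=> z0; have ig := integrable_risk_lr z0 risk_fun_g.
rewrite {2}/g le_min avgE; apply/andP; split.
  have -> : 1 = \int[P]_x (1 : R) by rewrite Rcst.
  apply: le_Rintegral => //; first exact: finite_measure_integrable_cst.
  by move=> x _; exact: g_le1.
have ilr : P.-integrable setT (EFin \o lr).
  apply/integrableP; split; first exact/measurable_EFinP.
  rewrite (eq_integral (fun x => (lr x)%:E)); last first.
    by move=> x _ /=; rewrite ger0_norm.
  by rewrite int_lr ltry.
rewrite [leRHS](_ : _ = \int[P]_x (z * lr x)); last first.
  by rewrite RintegralZl// /Rintegral int_lr mulr1.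
apply: le_Rintegral => //; last by move=> x _; exact: g_lez.
by exact: (integrableZl measurableT z ilr).
Qed.

Lemma avg_le_g h z : 0 <= z -> risk_fun h -> avg h z <= g z.
Proof.
move=> z0 rh; apply: le_trans (avg_g_le z0); apply: avg_le => //.
  exact: risk_fun_g.
by move=> y y0; case/andP: (rh.1 y y0).
Qed.

Lemma risk_fun_avg h : risk_fun h -> risk_fun (avg h).
Proof.
move=> rh; split=> [z z0|z z' z0 zz']; first by rewrite avg_ge0// avg_le_g.
rewrite !avgE; apply: le_Rintegral => //.
- exact: integrable_risk_lr.
- by apply: integrable_risk_lr => //; exact: le_trans zz'.
- by move=> x _; apply: rh.2; [exact: zlr|exact: ler_wpM2r].
Qed.

End Average.

(** * The value function *)

Section ValueFunction.
Context {d} {T : measurableType d} {R : realType}.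
Variables (P : probability T R) (lr : T -> R).
Hypotheses (lr0 : forall x, 0 <= lr x) (mlr : measurable_fun setT lr).
Hypothesis int_lr : (\int[P]_x (lr x)%:E = 1)%E.
Implicit Types (h : R -> R) (z c b e w : R) (k n : nat).

Local Notation avg := (avg P lr).

(** [n] counts the sure continuations still considered. [bellman] sets it to the integer part of c,
    the number that the budget affords, which makes the recursion structural. *)
Fixpoint horizon (A : R -> R -> R) n z c : R :=
  if n is n'.+1
  then Num.min (A z c) (avg (fun y => horizon A n' y (c - 1)) z)
  else A z c.

Definition bellman (A : R -> R -> R) z c : R := horizon A (Num.truncn c) z c.

(** The stopping probability 1 - c/b requires b >= c, and b >= 1 pays for the next observation. With
    E the cost of continuing, (1 - c/b) g + (c/b) E = g - c (g - E)/b, so c enters the choice of b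
    only through its range. *)
Fixpoint gamble k : R -> R -> R :=
  if k is k'.+1 then fun z c =>
    g z - c * sup [set (g z - avg (fun y => bellman (gamble k') y (b - 1)) z) / b
                  | b in `[Num.max 1 c, +oo[]
  else fun z _ => g z.

(* [value k z c] turns out to be rho_k(z, c); [gamble] covers the policies that
   may stop at once, and [bellman] adds the option to continue for sure while
   the budget [c] allows it. *)
Definition value k z c : R := bellman (gamble k) z c.

Definition cont_value k z b : R := avg (fun y => value k y (b - 1)) z.

Definition slope k z b : R := (g z - cont_value k z b) / b.

Lemma bellman_lt1 A z c : c < 1 -> bellman A z c = A z c.
Proof.
move=> c1; rewrite /bellman.
suff -> : Num.truncn c = 0%N by [].
by apply/eqP; rewrite -leqn0 -ltnS ltnS leqNgt truncn_gt0 -ltNge.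
Qed.

Lemma truncn_predr c : 1 <= c -> Num.truncn c = (Num.truncn (c - 1)).+1.
Proof.
move=> c1; have c10 : 0 <= c - 1 by rewrite subr_ge0.
have /andP[h1 h2] := truncn_itv c10; apply: truncn_def.
by rewrite -natr1 -(natr1 _.+1) -lerBrDr h1 -ltrBlDr.
Qed.

Lemma bellman_ge1 A z c : 1 <= c ->
  bellman A z c = Num.min (A z c) (avg (fun y => bellman A y (c - 1)) z).
Proof. by move=> c1; rewrite /bellman truncn_predr. Qed.

Lemma bellman_le A z c : bellman A z c <= A z c.
Proof.
have [c1|c1] := ltP c 1; first by rewrite bellman_lt1.
by rewrite bellman_ge1// ge_min lexx.
Qed.

Lemma risk_fun_min h h' : risk_fun h -> risk_fun h' ->
  risk_fun (fun z => Num.min (h z) (h' z)).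
Proof.
move=> [h01 hm] [h'01 h'm]; split=> [z z0|z z' z0 zz'].
  have /andP[a b] := h01 z z0; have /andP[a' b'] := h'01 z z0.
  by rewrite le_min a a' ge_min b.
by rewrite le_min !ge_min hm// h'm// orbT.
Qed.

(** Properties preserved by [bellman]. The last one compares only budgets that afford the same
    number of sure continuations. *)
Definition loss_fun (W : R -> R -> R) :=
  [/\ forall c, 0 <= c -> risk_fun (W ^~ c),
      forall z c c', 0 <= z -> 0 <= c -> c <= c' -> W z c' <= W z c &
      forall z c c', 0 <= z -> 0 <= c -> c <= c' ->
        Num.truncn c = Num.truncn c' -> W z c <= W z c' + (c' - c)].

Lemma real_nat_ind (Q : R -> Prop) :
  (forall c, 0 <= c -> c < 1 -> Q c) ->
  (forall c, 1 <= c -> Q (c - 1) -> Q c) -> forall c, 0 <= c -> Q c.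
Proof.
move=> Q0 QS c c0.
have [n cn] : exists n, c < n%:R by exists (Num.truncn c).+1; exact: truncnS_gt.
elim: n c c0 cn => [c c0|n IH c c0 cn].
  by rewrite ltNge c0.
have [c1|c1] := ltP c 1; first exact: Q0.
apply: QS => //; apply: IH; first by rewrite subr_ge0.
by rewrite ltrBlDr natr1.
Qed.

Lemma loss_fun_bellman A :
  (forall c, 0 <= c -> risk_fun (A ^~ c)) ->
  (forall z c c', 0 <= z -> 0 <= c -> c <= c' -> A z c' <= A z c) ->
  (forall z c c', 0 <= z -> 0 <= c -> c <= c' -> A z c <= A z c' + (c' - c)) ->
  loss_fun (bellman A).
Proof.
move=> Ar An Al.
have Wr c : 0 <= c -> risk_fun ((bellman A)^~ c).
  move: c; apply: real_nat_ind => c.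
    by move=> c0 c1; under eq_fun do rewrite bellman_lt1//; exact: Ar.
  move=> c1 rc; under eq_fun do rewrite bellman_ge1//.
  apply: risk_fun_min; first by apply: Ar; exact: le_trans c1.
  exact: risk_fun_avg.
split=> //.
- move=> z c c' z0 c0; elim/real_nat_ind: c / c0 z c' z0 => c.
    move=> c0 c1 z c' z0 cc'; rewrite (bellman_lt1 _ _ c1).
    by apply: le_trans (bellman_le _ _ _) _; exact: An.
  move=> c1 IH z c' z0 cc'; have c'1 := le_trans c1 cc'.
  have c0 : 0 <= c by exact: le_trans c1.
  rewrite !bellman_ge1// le_min !ge_min An//=; apply/orP; right.
  apply: avg_le => //; [apply: Wr|apply: Wr|]; rewrite ?subr_ge0//.
  by move=> y y0; apply: IH => //; rewrite lerB.
- move=> z c c' z0 c0; elim/real_nat_ind: c / c0 z c' z0 => c.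
    move=> c0 c1 z c' z0 cc' tcc'.
    have c'1 : c' < 1.
      by rewrite ltNge -truncn_gt0 -tcc' truncn_gt0 -ltNge.
    by rewrite !bellman_lt1//; exact: Al.
  move=> c1 IH z c' z0 cc' tcc'; have c'1 := le_trans c1 cc'.
  have c0 : 0 <= c by exact: le_trans c1.
  have c10 : 0 <= c - 1 by rewrite subr_ge0.
  have c'10 : 0 <= c' - 1 by rewrite subr_ge0.
  rewrite !bellman_ge1// addr_minl le_min !ge_min Al//=; apply/orP; right.
  have := @avg_le_lin _ _ _ P lr lr0 mlr (fun y => bellman A y (c - 1))
    (fun y => bellman A y (c' - 1)) (fun y => bellman A y (c' - 1)) 1 0 (c' - c) z z0.
  rewrite mul1r mul0r addr0; apply; [exact: Wr|exact: Wr|exact: Wr|].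
  move=> y y0; rewrite mul1r mul0r addr0.
  have -> : c' - c = (c' - 1) - (c - 1) by lra.
  apply: IH => //; first by rewrite lerB.
  by apply: succn_inj; rewrite -!truncn_predr.
Qed.

(** * Slopes of chords and regularity of the value function *)

Section slope_loss.
Variable k : nat.
Hypothesis lossV : loss_fun (value k).

Let risk_value b : 1 <= b -> risk_fun (fun y => value k y (b - 1)).
Proof. by move=> b1; case: lossV => r _ _; apply: r; rewrite subr_ge0. Qed.

Lemma cont_value_itv z b : 0 <= z -> 1 <= b -> 0 <= cont_value k z b <= g z.
Proof. by move=> z0 b1; rewrite avg_ge0 ?avg_le_g//; exact: risk_value. Qed.

Lemma cont_value_mono z z' b : 1 <= b -> 0 <= z -> z <= z' ->
  cont_value k z b <= cont_value k z' b.
Proof.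
move=> b1 z0 zz'.
by have [_ +] := risk_fun_avg lr0 mlr int_lr (risk_value b1); apply.
Qed.

Lemma cont_value_anti z b b' : 0 <= z -> 1 <= b -> b <= b' ->
  cont_value k z b' <= cont_value k z b.
Proof.
move=> z0 b1 bb'; have b'1 := le_trans b1 bb'.
apply: avg_le => //; [exact: risk_value|exact: risk_value|move=> y y0].
by case: lossV => _ + _; apply => //; rewrite ?subr_ge0 ?lerB.
Qed.

Lemma cont_value_lip z b b' : 0 <= z -> 1 <= b -> b <= b' ->
  Num.truncn b = Num.truncn b' -> cont_value k z b <= cont_value k z b' + (b' - b).
Proof.
move=> z0 b1 bb' tbb'; have b'1 := le_trans b1 bb'.
have := @avg_le_lin _ _ _ P lr lr0 mlr (fun y => value k y (b - 1))
    (fun y => value k y (b' - 1)) (fun y => value k y (b' - 1)) 1 0 (b' - b) z z0.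
rewrite mul1r mul0r addr0; apply; [exact: risk_value..|move=> y y0].
rewrite mul1r mul0r addr0.
have -> : b' - b = (b' - 1) - (b - 1) by lra.
case: lossV => _ _; apply => //; rewrite ?subr_ge0 ?lerB//.
by apply: succn_inj; rewrite -!truncn_predr.
Qed.

Lemma slope_ge0 z b : 0 <= z -> 1 <= b -> 0 <= slope k z b.
Proof.
move=> z0 b1; have /andP[_ le] := cont_value_itv z0 b1.
by rewrite divr_ge0 ?subr_ge0// (le_trans ler01).
Qed.

Lemma slope_le1 z b : 0 <= z -> 1 <= b -> slope k z b <= 1.
Proof.
move=> z0 b1; have /andP[ge _] := cont_value_itv z0 b1.
rewrite ler_pdivrMr ?(lt_le_trans ltr01)// mul1r (le_trans _ b1)//.
by have := g_le1 z; move: ge; lra.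
Qed.

Lemma slopeE z b : 1 <= b -> b * slope k z b = g z - cont_value k z b.
Proof. by move=> b1; rewrite mulrC divfK// gt_eqF// (lt_le_trans ltr01). Qed.

Lemma slope_argmax z m : 0 <= z -> 1 <= m -> exists b,
  [/\ m <= b, forall b', m <= b' -> slope k z b' <= slope k z b &
      forall a, m <= a -> a < b -> exists2 e, 0 < e &
        forall b', m <= b' -> b' <= a -> slope k z b' <= slope k z b - e].
Proof.
move=> z0 m1; apply: ratio_argmax => // [b b1|b b' b1 bb'|b b' b1 bb' tbb'].
- have /andP[h1 h2] := cont_value_itv z0 b1.
  by have := g_le1 z; move: h1 h2; lra.
- by rewrite lerB// cont_value_anti.
- by have := cont_value_lip z0 b1 bb' tbb'; lra.
Qed.

Lemma sup_slope z m b : m <= b -> (forall b', m <= b' -> slope k z b' <= slope k z b) ->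
  sup [set slope k z b' | b' in `[m, +oo[] = slope k z b.
Proof.
move=> mb bmax; apply/eqP; rewrite eq_le; apply/andP; split.
  apply: ge_sup; first by exists (slope k z b), b => //=; rewrite in_itv/= mb.
  by move=> _ [b' mb' <-]; apply: bmax; move: mb'; rewrite /= in_itv/= andbT.
apply: ub_le_sup; last by exists b => //=; rewrite in_itv/= mb.
by exists (slope k z b) => _ [b' mb' <-]; apply: bmax; move: mb'; rewrite /= in_itv/= andbT.
Qed.

Lemma gambleS z c : gamble k.+1 z c =
  g z - c * sup [set slope k z b | b in `[Num.max 1 c, +oo[].
Proof. by []. Qed.

Lemma gamble_argmax z c b : Num.max 1 c <= b ->
  (forall b', Num.max 1 c <= b' -> slope k z b' <= slope k z b) ->
  gamble k.+1 z c = g z - c * slope k z b.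
Proof. by move=> cb bmax; rewrite gambleS (sup_slope cb bmax). Qed.

Lemma gamble_ex z c : 0 <= z -> exists b, Num.max 1 c <= b /\
  gamble k.+1 z c = g z - c * slope k z b /\
  (forall b', Num.max 1 c <= b' -> slope k z b' <= slope k z b).
Proof.
move=> z0; have m1 : 1 <= Num.max 1 c by rewrite le_max lexx.
have [b [mb bmax _]] := slope_argmax z0 m1.
by exists b; rewrite (gamble_argmax mb bmax).
Qed.

Lemma gamble_le z c b : 0 <= z -> 0 <= c -> Num.max 1 c <= b ->
  gamble k.+1 z c <= g z - c * slope k z b.
Proof.
move=> z0 c0 cb; have [b' [_ [-> bmax]]] := gamble_ex c z0.
by rewrite lerB// ler_wpM2l// bmax.
Qed.

Lemma loss_fun_valueS : loss_fun (value k.+1).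
Proof.
have max1 c : 1 <= Num.max 1 c by rewrite le_max lexx.
apply: loss_fun_bellman => [c c0|z c c' z0 c0 cc'|z c c' z0 c0 cc'].
- split=> [z z0|z z' z0 zz'].
    have [b [cb [-> _]]] := gamble_ex c z0; have b1 := le_trans (max1 c) cb.
    have cb' : c <= b by move: cb; rewrite ge_max => /andP[].
    have r0 := slope_ge0 z0 b1.
    have /andP[e0 _] := cont_value_itv z0 b1.
    rewrite gerBl mulr_ge0// andbT subr_ge0.
    apply: (@le_trans _ _ (b * slope k z b)); first by rewrite ler_wpM2r.
    by rewrite slopeE// gerBl.
  (* The maximizer for z' is also a candidate at z; for fixed b the gamble is a convex combination
     of [g] and [cont_value], both nondecreasing in z. *)
  have z'0 := le_trans z0 zz'.
  have [b [cb [-> _]]] := gamble_ex c z'0; have b1 := le_trans (max1 c) cb.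
  have cb' : c <= b by move: cb; rewrite ge_max => /andP[].
  apply: le_trans (gamble_le z0 c0 cb) _.
  have b0 : 0 < b := lt_le_trans ltr01 b1.
  have E y : g y - c * slope k y b = (1 - c / b) * g y + (c / b) * cont_value k y b.
    by rewrite /slope; field; rewrite gt_eqF.
  rewrite !E lerD// ler_wpM2l//.
  - by rewrite subr_ge0 ler_pdivrMr// mul1r.
  - by apply: (@risk_fun_g R).2.
  - by rewrite divr_ge0// ltW.
  - exact: cont_value_mono.
- have [b [cb [-> _]]] := gamble_ex c z0; have b1 := le_trans (max1 c) cb.
  have cb' : c <= b by move: cb; rewrite ge_max => /andP[].
  have c'0 := le_trans c0 cc'.
  have [c'b|bc'] := leP c' b.
    apply: le_trans (gamble_le (b := b) z0 c'0 _) _; first by rewrite ge_max b1.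
    by rewrite lerB// ler_wpM2r// slope_ge0.
  (* Here c' exceeds the maximizer for c, so the candidate b = c' is used; b * slope k z b is
     nondecreasing in b. *)
  have c'1 := le_trans b1 (ltW bc').
  apply: le_trans (gamble_le (b := c') z0 c'0 _) _; first by rewrite ge_max c'1 lexx.
  rewrite lerB//; apply: (@le_trans _ _ (b * slope k z b)).
    by rewrite ler_wpM2r// slope_ge0.
  by rewrite !slopeE// lerB// cont_value_anti// ltW.
- have c'0 := le_trans c0 cc'.
  (* The maximizer for c' is a candidate for the smaller c, and slopes are at most 1. *)
  have [b [cb [-> bmax]]] := gamble_ex c' z0; have b1 := le_trans (max1 c') cb.
  have cb' : Num.max 1 c <= b.
    by apply: le_trans cb; rewrite ge_max !le_max lexx cc' orbT.
  apply: le_trans (gamble_le z0 c0 cb') _.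
  have r1 := slope_le1 z0 b1; have r0 := slope_ge0 z0 b1.
  have : (c' - c) * slope k z b <= c' - c by rewrite ler_piMr// subr_ge0.
  by rewrite mulrBl; lra.
Qed.

End slope_loss.

Lemma loss_fun_value k : loss_fun (value k).
Proof.
elim: k => [|k IH]; last exact: loss_fun_valueS.
apply: loss_fun_bellman => [c c0|z c c' z0 c0 cc'|z c c' z0 c0 cc'] //=.
- exact: risk_fun_g.
- by rewrite lerDl subr_ge0.
Qed.

Lemma value_le_gamble k z c : value k z c <= gamble k z c.
Proof. exact: bellman_le. Qed.

Lemma value_le_slope k z c b : 0 <= z -> 0 <= c -> Num.max 1 c <= b ->
  value k.+1 z c <= g z - c * slope k z b.
Proof.
move=> z0 c0 cb; apply: le_trans (value_le_gamble _ _ _) _.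
exact: (gamble_le (loss_fun_value k)).
Qed.

Lemma value_ge1 k z c : 1 <= c ->
  value k z c = Num.min (gamble k z c) (cont_value k z c).
Proof. exact: bellman_ge1. Qed.

Lemma value_lt1 k z c : c < 1 -> value k z c = gamble k z c.
Proof. exact: bellman_lt1. Qed.

Lemma value_le_cont k z c : 1 <= c -> value k z c <= cont_value k z c.
Proof. by move=> c1; rewrite value_ge1// ge_min lexx orbT. Qed.

(** Moving the end points to the right while keeping the mean c forces mu >= w. The share of c
    carried by the left end, where the rate is larger, thus grows from w b1 to mu b1'. *)
Lemma chord_arith (w c b1 b2 b1' b2' r1 r2 mu : R) :
  0 <= w <= 1 -> b1 <= b1' -> b2 <= b2' -> c = w * b1 + (1 - w) * b2 ->
  c = mu * b1' + (1 - mu) * b2' -> 0 <= b1 -> 0 <= b2 -> b1' < b2' -> r2 <= r1 ->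
  w * (b1 * r1) + (1 - w) * (b2 * r2) <=
  mu * (b1' * r1) + (1 - mu) * (b2' * r2).
Proof.
move=> /andP[w0 w1] b11 b22 cE cE' b10 b20 b12 r21.
have wmu : w <= mu.
  rewrite leNgt; apply/negP => muw.
  have h1 : w * b1 <= w * b1' by rewrite ler_wpM2l.
  have h2 : (1 - w) * b2 <= (1 - w) * b2' by rewrite ler_wpM2l// subr_ge0.
  have h3 : 0 < (w - mu) * (b2' - b1') by rewrite mulr_gt0// subr_gt0.
  by move: h1 h2 h3; rewrite !mulrBr !mulrBl; move: cE cE'; rewrite !mulrBl; lra.
have -> : w * (b1 * r1) + (1 - w) * (b2 * r2) = c * r2 + (w * b1) * (r1 - r2).
  by rewrite cE; ring.
have -> : mu * (b1' * r1) + (1 - mu) * (b2' * r2) = c * r2 + (mu * b1') * (r1 - r2).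
  by rewrite cE'; ring.
rewrite lerD2l ler_wpM2r ?subr_ge0//; apply: (@le_trans _ _ (w * b1')).
  by rewrite ler_wpM2l.
by rewrite ler_wpM2r// (le_trans b10).
Qed.

(** * Mixtures of two budgets *)

Let chord k := forall z b, 0 <= z -> 0 <= b -> exists b',
  Num.max 1 b <= b' /\ g z - b * slope k z b' <= value k z b.

(* Mixing two budgets costs only one more randomized decision: each value lies
   above a chord from (0, g z) to some (b', cont_value k z b'), so either the
   steeper of the two chords is available at c, or c lies between their
   endpoints and continuing for sure lets the induction on c apply. *)
Let chord_mix k : chord k -> forall c, 0 <= c -> forall w b1 b2 z,
  0 <= w <= 1 -> 0 <= b1 -> 0 <= b2 -> 0 <= z -> c = w * b1 + (1 - w) * b2 ->
  value k.+1 z c <= w * value k z b1 + (1 - w) * value k z b2.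
Proof.
move=> chordk.
pose Q c := forall w b1 b2 z,
  0 <= w <= 1 -> 0 <= b1 -> 0 <= b2 -> 0 <= z -> c = w * b1 + (1 - w) * b2 ->
  value k.+1 z c <= w * value k z b1 + (1 - w) * value k z b2.
have step c : 0 <= c -> (1 <= c -> Q (c - 1)) -> Q c.
  move=> c0 IH w b1 b2 z w01 b10 b20 z0 cE.
  have [b1' [mb1' le1]] := chordk z b1 z0 b10.
  have [b2' [mb2' le2]] := chordk z b2 z0 b20.
  wlog b12 : w b1 b2 b1' b2' w01 b10 b20 cE mb1' mb2' le1 le2 / b1' <= b2'.
    move=> wlog; have [h|/ltW h] := leP b1' b2'; first exact: (wlog w b1 b2 b1' b2').
    have ww : 1 - (1 - w) = w by ring.
    rewrite [leRHS]addrC.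
    have := wlog (1 - w) b2 b1 b2' b1'; rewrite ww; apply => //.
    - by rewrite subr_ge0 gerBl; case/andP: w01 => -> ->.
    - by rewrite addrC.
  have /andP[w0 w1] := w01; have w1' : 0 <= 1 - w by rewrite subr_ge0.
  have /andP[b1'1 bb1] : (1 <= b1') && (b1 <= b1') by rewrite -ge_max.
  have /andP[b2'1 bb2] : (1 <= b2') && (b2 <= b2') by rewrite -ge_max.
  have cb2' : c <= b2'.
    have h1 : w * b1 <= w * b2' by rewrite ler_wpM2l// (le_trans bb1).
    have h2 : (1 - w) * b2 <= (1 - w) * b2' by rewrite ler_wpM2l.
    by move: h1 h2; rewrite cE !mulrBl; lra.
  have tgt : g z - (w * (b1 * slope k z b1') + (1 - w) * (b2 * slope k z b2')) <=
      w * value k z b1 + (1 - w) * value k z b2.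
    have h1 : w * (g z - b1 * slope k z b1') <= w * value k z b1.
      by rewrite ler_wpM2l.
    have h2 : (1 - w) * (g z - b2 * slope k z b2') <= (1 - w) * value k z b2.
      by rewrite ler_wpM2l.
    by move: h1 h2; rewrite !mulrBr !mulrBl; lra.
  apply: le_trans tgt; have wb1 : 0 <= w * b1 by exact: mulr_ge0.
  have wb2 : 0 <= (1 - w) * b2 by exact: mulr_ge0.
  have [s12|s21] := leP (slope k z b1') (slope k z b2').
    apply: le_trans (value_le_slope (b := b2') k z0 c0 _) _.
      by rewrite ge_max b2'1.
    have -> : c * slope k z b2' =
        w * (b1 * slope k z b2') + (1 - w) * (b2 * slope k z b2').
      by rewrite cE; ring.
    by rewrite lerB// lerD2r !(mulrA w) ler_wpM2l.
  have [cb1'|b1'c] := leP c b1'.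
    apply: le_trans (value_le_slope (b := b1') k z0 c0 _) _.
      by rewrite ge_max b1'1.
    have -> : c * slope k z b1' =
        w * (b1 * slope k z b1') + (1 - w) * (b2 * slope k z b1').
      by rewrite cE; ring.
    by rewrite lerB// lerD2l !(mulrA (1 - w)) ler_wpM2l// ltW.
  have c1 : 1 <= c by exact: le_trans (ltW b1'c).
  have bb0 : 0 < b2' - b1' by rewrite subr_gt0 (lt_le_trans b1'c).
  (* c - 1 is the mixture of b1' - 1 and b2' - 1 with weight [mu], so the induction hypothesis
     applies inside the average. *)
  pose mu := (b2' - c) / (b2' - b1').
  have mu01 : 0 <= mu <= 1.
    have b12' := ltW (lt_le_trans b1'c cb2').
    rewrite divr_ge0 ?subr_ge0//=.
    by rewrite ler_pdivrMr// mul1r lerB// ltW.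
  have cmu : c = mu * b1' + (1 - mu) * b2'.
    by rewrite /mu; field; rewrite gt_eqF.
  apply: le_trans (value_le_cont _ _ c1) _.
  apply: (@le_trans _ _ (mu * cont_value k z b1' + (1 - mu) * cont_value k z b2')).
    have b11' : 0 <= b1' - 1 by rewrite subr_ge0.
    have b21' : 0 <= b2' - 1 by rewrite subr_ge0.
    have [r _ _] := loss_fun_value k; have [r' _ _] := loss_fun_value k.+1.
    have := @avg_le_lin _ _ _ P lr lr0 mlr (fun y => value k.+1 y (c - 1))
      (fun y => value k y (b1' - 1)) (fun y => value k y (b2' - 1)) mu (1 - mu) 0 z z0.
    rewrite addr0; apply; [apply: r'|exact: r|exact: r|move=> y y0].
      by rewrite subr_ge0.
    rewrite addr0; apply: (IH c1) => //.
    by rewrite {1}cmu; ring.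
  have e y : 1 <= y -> cont_value k z y = g z - y * slope k z y.
    by move=> y1; rewrite slopeE// opprB addrC subrK.
  rewrite !e//.
  have := chord_arith w01 bb1 bb2 cE cmu b10 b20 _ (ltW s21).
  rewrite -subr_gt0 bb0 => /(_ isT).
  by rewrite !mulrBr !mulrBl; lra.
by move=> c c0; elim/real_nat_ind: c / c0 => c *; apply: step => //; lra.
Qed.

(** [gamble k.+1] follows a chord of level k, which lies above the chord of level k.+1 to the same
    b' because continuing does not cost more at level k.+1. A sure continuation is the chord with b'
    = b. *)
Let chord_le k : (forall z c, 0 <= z -> 0 <= c -> value k.+1 z c <= value k z c) ->
  chord k.+1.
Proof.
move=> vle z b z0 b0; have lossk := loss_fun_value k.
have le_g c : 1 <= c -> cont_value k.+1 z c <= cont_value k z c.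
  move=> c1; have c10 : 0 <= c - 1 by rewrite subr_ge0.
  have [r' _ _] := loss_fun_value k.+1; have [r _ _] := lossk.
  by apply: avg_le => //; [exact: r'|exact: r|move=> y y0; exact: vle].
have max1 c : 1 <= Num.max 1 c by rewrite le_max lexx.
have gam : exists b', Num.max 1 b <= b' /\ g z - b * slope k.+1 z b' <= gamble k.+1 z b.
  have [b' [mb' [-> _]]] := gamble_ex lossk b z0.
  have b'1 := le_trans (max1 b) mb'.
  exists b'; split => //; apply: lerB => //; apply: ler_wpM2l => //.
  apply: ler_wpM2r; first by rewrite invr_ge0 (le_trans ler01).
  by apply: lerB => //; exact: le_g.
move: gam; have [b1|b1] := ltP b 1; first by rewrite value_lt1.
rewrite value_ge1//; case: leP => // _ _.
exists b; split => //; rewrite slopeE//; lra.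
Qed.

Let chord0 : chord 0.
Proof.
move=> z b z0 b0.
have [b1|b1] := ltP b 1.
  exists 1; split => //.
  rewrite value_lt1//= gerBl mulr_ge0//.
  by apply: slope_ge0 => //; exact: loss_fun_value.
exists b; split => //; rewrite slopeE// value_ge1// le_min /= gerBl subr_ge0.
have /andP[_ ->] := cont_value_itv (loss_fun_value 0) z0 b1.
by rewrite opprB addrC subrK lexx.
Qed.

(** Proved by induction together with [chord k]: a mixture with weight 1 turns [chord k] into this
    inequality, and [chord_le] turns the inequality into [chord k.+1]. *)
Lemma valueS_le k z c : 0 <= z -> 0 <= c -> value k.+1 z c <= value k z c.
Proof.
move=> z0 c0; suff: chord k.
  move=> /chord_mix /(_ c c0 1 c c z); rewrite subrr !mul0r !addr0 !mul1r.
  by apply => //; rewrite ler01 lexx.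
elim: k => [|k IH] in z c z0 c0 *; first exact: chord0.
apply: chord_le => y b y0 b0.
have := chord_mix (IH y b y0 b0) b0; move=> /(_ 1 b b y).
rewrite subrr !mul0r !addr0 !mul1r; apply => //; by rewrite ler01 lexx.
Qed.

Let chord_value k : chord k.
Proof.
case: k => [|k]; first exact: chord0.
by apply: chord_le => z c; exact: valueS_le.
Qed.

Lemma value_mix k w b1 b2 z : 0 <= w <= 1 -> 0 <= b1 -> 0 <= b2 -> 0 <= z ->
  value k.+1 z (w * b1 + (1 - w) * b2) <=
  w * value k z b1 + (1 - w) * value k z b2.
Proof.
move=> /[dup] w01 /andP[w0 w1] b10 b20 z0; apply: (chord_mix (@chord_value k)) => //.
by rewrite addr_ge0// mulr_ge0// subr_ge0.
Qed.

Lemma cont_value_mix k w b1 b2 z : 0 <= w <= 1 -> 1 <= b1 -> 1 <= b2 -> 0 <= z ->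
  cont_value k.+1 z (w * b1 + (1 - w) * b2) <=
  w * cont_value k z b1 + (1 - w) * cont_value k z b2.
Proof.
move=> /[dup] w01 /andP[w0 w1] b11 b21 z0.
have b11' : 0 <= b1 - 1 by rewrite subr_ge0.
have b21' : 0 <= b2 - 1 by rewrite subr_ge0.
have cE : w * b1 + (1 - w) * b2 - 1 = w * (b1 - 1) + (1 - w) * (b2 - 1) by ring.
have [r _ _] := loss_fun_value k; have [r' _ _] := loss_fun_value k.+1.
have := @avg_le_lin _ _ _ P lr lr0 mlr
  (fun y => value k.+1 y (w * b1 + (1 - w) * b2 - 1))
  (fun y => value k y (b1 - 1)) (fun y => value k y (b2 - 1)) w (1 - w) 0 z z0.
rewrite addr0; apply; [apply: r'|exact: r|exact: r|move=> y y0].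
  by rewrite cE addr_ge0// mulr_ge0// subr_ge0.
by rewrite addr0 cE; exact: value_mix.
Qed.

(* This is why b* may maximize over b >= 1 instead of b >= c. *)
Lemma cont_le_gamble k z c b : 0 <= z -> 1 <= c -> 1 <= b -> b <= c ->
  (forall b', 1 <= b' -> slope k z b' <= slope k z b) ->
  cont_value k.+1 z c <= gamble k.+1 z c.
Proof.
move=> z0 c1 b1 bc bmax; have lossk := loss_fun_value k.
have [b' [cb' [-> b'max]]] := gamble_ex lossk c z0.
have /andP[b'1 cb] : (1 <= b') && (c <= b') by rewrite -ge_max.
have [b'b|bb'] := leP b' b.
  have -> : b' = c by apply/eqP; rewrite eq_le cb (le_trans b'b).
  rewrite slopeE// opprB addrC subrK.
  have c10 : 0 <= c - 1 by rewrite subr_ge0.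
  have [r' _ _] := loss_fun_value k.+1; have [r _ _] := lossk.
  by apply: avg_le => //; [exact: r'|exact: r|move=> y y0; exact: valueS_le].
(* c lies between b and b'. By [cont_value_mix] the sure continuation costs at most the mean of the
   two ends, which is below the chord to b' since the slope at b is at least as large. *)
pose w := (b' - c) / (b' - b).
have bb0 : 0 < b' - b by rewrite subr_gt0.
have w01 : 0 <= w <= 1.
  have bb := ltW bb'.
  by rewrite divr_ge0 ?subr_ge0//= ler_pdivrMr// mul1r lerB.
have cE : c = w * b + (1 - w) * b'.
  by rewrite /w; field; rewrite gt_eqF.
rewrite {1}cE; apply: le_trans (cont_value_mix k w01 b1 b'1 z0) _.
have e y : 1 <= y -> cont_value k z y = g z - y * slope k z y.
  by move=> y1; rewrite slopeE// opprB addrC subrK.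
rewrite !e// {1}cE.
have : w * b * slope k z b' <= w * b * slope k z b.
  case/andP: w01 => w0 _.
  by rewrite ler_wpM2l ?bmax// mulr_ge0// (le_trans ler01).
rewrite !mulrBr !mulrBl !mulrDl; lra.
Qed.

End ValueFunction.

(** * Measurable selection *)

Section JointMeasurability.
Context {R : realType}.

Lemma lt_eps_rat (a e : R) : 0 < e -> exists q : rat, a < ratr q < a + e.
Proof.
move=> e0; have [|q] := @rat_in_itvoo R a (a + e); first by rewrite ltrDl.
by rewrite in_itv /= => h; exists q.
Qed.

(* Monotonicity and right-continuity make the superlevel sets countable unions
   of rectangles. *)
Lemma measurable_mono2 (f : R -> R -> R) (m : R) : 0 <= m ->
  (forall c z z', m <= c -> 0 <= z -> z <= z' -> f z c <= f z' c) ->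
  (forall z c c', 0 <= z -> m <= c -> c <= c' -> f z c' <= f z c) ->
  (forall z c c', 0 <= z -> m <= c -> c <= c' ->
     Num.truncn c = Num.truncn c' -> f z c <= f z c' + (c' - c)) ->
  measurable_fun ((`[0, +oo[ : set R) `*` (`[m, +oo[ : set R))
    (fun u : R * R => f u.1 u.2).
Proof.
move=> m0 fz fc fl.
apply: (measurability (@RGenOInfty.G R)); first exact: RGenOInfty.measurableE.
move=> _ [_ [a ->] <-].
have -> : (`[0, +oo[ `*` `[m, +oo[) `&` (fun u : R * R => f u.1 u.2) @^-1` `]a, +oo[ =
    \bigcup_(q : rat) (((`[0, +oo[ : set R) `&`
      (f ^~ (Num.max m (ratr q))) @^-1` `]a, +oo[) `*` (`[m, (ratr q : R)[ : set R)).
  apply/seteqP; split => [[z c] /= []|[z c] /= [q _ []]].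
    rewrite !in_itv/= !andbT => -[z0 mc] afzc.
    have c0 : 0 <= c by exact: le_trans mc.
    have /andP[tc1 tc2] := truncn_itv c0.
    (* The rational above c must stay below the next integer, for the Lipschitz bound, and within f
       z c - a of c, to keep f above a. *)
    have e0 : 0 < Num.min (f z c - a) ((Num.truncn c).+1%:R - c).
      by rewrite lt_min !subr_gt0 afzc.
    have [q /andP[cq qe]] := lt_eps_rat c e0.
    exists q => //=; rewrite !in_itv/= !andbT z0 mc cq; split => //; split => //.
    have mq : m <= ratr q by rewrite (le_trans mc)// ltW.
    rewrite (max_idPr mq).
    have tq : Num.truncn c = Num.truncn (ratr q : R).
      apply/esym/truncn_def; rewrite (le_trans tc1 (ltW cq))/=.
      rewrite -(subrK c (_%:R)) addrC; apply: lt_le_trans qe _.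
      by rewrite lerD2l ge_min lexx orbT.
    have := fl z c _ z0 mc (ltW cq) tq.
    have : Num.min (f z c - a) ((Num.truncn c).+1%:R - c) <= f z c - a.
      by rewrite ge_min lexx.
    by move: qe; lra.
  rewrite /= !in_itv/= !andbT => -[z0 afq] /andP[mc cq]; split => //.
  have mq : m <= ratr q by rewrite (le_trans mc)// ltW.
  rewrite (max_idPr mq) in afq.
  by apply: lt_le_trans afq _; apply: fc => //; exact: ltW.
apply: bigcupT_measurable_rat => q; apply: measurableX => //.
have mfz : measurable_fun (`[0, +oo[ : set R) (f ^~ (Num.max m (ratr q))).
  apply: measurable_nonneg_mono => z z' z0 zz'; apply: fz => //.
  by rewrite le_max lexx.
exact: mfz.
Qed.

End JointMeasurability.

(** * A measurable choice of the maximizer *)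

Section Selection.
Context {d} {T : measurableType d} {R : realType}.
Variables (P : probability T R) (lr : T -> R).
Hypotheses (lr0 : forall x, 0 <= lr x) (mlr : measurable_fun setT lr).
Hypothesis int_lr : (\int[P]_x (lr x)%:E = 1)%E.
Local Notation value := (value P lr).
Local Notation cont_value := (cont_value P lr).
Local Notation slope := (slope P lr).

Let loss k : loss_fun (value k) := loss_fun_value lr0 mlr int_lr k.

Lemma measurable_slope k b : 1 <= b ->
  measurable_fun (`[0, +oo[ : set R) (slope k ^~ b).
Proof.
move=> b1; apply: measurable_funM => //; apply: measurable_funB.
  by apply: measurable_funTS; exact: measurable_g.
apply: measurable_nonneg_mono => z z' z0 zz'.
exact: (cont_value_mono lr0 mlr int_lr (loss k)).
Qed.

(** As b * slope k z b is nondecreasing in b and slopes are at most 1, the loss is at most b' - b,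
    so d = e works. This lets rationals slightly to the right replace a given b. *)
Lemma slope_approx k (z b e : R) : 0 <= z -> 1 <= b -> 0 < e ->
  exists2 d, 0 < d & forall b', b <= b' -> b' <= b + d -> slope k z b - e <= slope k z b'.
Proof.
move=> z0 b1 e0; exists e => // b' bb' b'd.
have b'1 := le_trans b1 bb'; have b0 := lt_le_trans ltr01 b1.
have s0 := slope_ge0 lr0 mlr int_lr (loss k) z0 b1.
have s1 := slope_le1 lr0 mlr int_lr (loss k) z0 b1.
have b'0 := lt_le_trans ltr01 b'1.
rewrite -(ler_pM2l b'0) slopeE//.
have : b * slope k z b <= g z - cont_value k z b'.
  by rewrite slopeE// lerB// (cont_value_anti lr0 mlr (loss k)).
have h1 : (b' - b) * slope k z b <= (b' - b) * 1 by rewrite ler_wpM2l// subr_ge0.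
have h2 : e <= b' * e by rewrite ler_peMl// ltW.
by move: h1 h2 b'd; rewrite mulrBl mulrBr; lra.
Qed.

(** The leftmost maximizer exceeds a exactly when the slopes on [1, a] stay below the maximum by a
    positive margin; [slope_approx] reduces this to countably many comparisons at rational
    points. *)
Lemma argmax_selection_value : exists amax : nat -> R -> R, forall k,
  measurable_fun (`[0, +oo[ : set R) (amax k) /\
  forall z, 0 <= z -> is_max_on (slope k z) 1 (amax k z).
Proof.
have ex k (z : R) : exists b, 0 <= z ->
  [/\ 1 <= b, forall b', 1 <= b' -> slope k z b' <= slope k z b &
      forall a, 1 <= a -> a < b -> exists2 e : R, 0 < e &
        forall b', 1 <= b' -> b' <= a -> slope k z b' <= slope k z b - e].
  have [z0|z0] := pselect (0 <= z); last by exists 0.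
  by have [b h] := slope_argmax lr0 mlr int_lr (loss k) z0 (lexx 1); exists b.
pose amax k z := projT1 (cid (ex k z)).
have amaxP k z := projT2 (cid (ex k z)).
exists amax => k; split => [|z z0]; last by have [] := amaxP k z z0.
apply: (measurability (@RGenOInfty.G R)); first exact: RGenOInfty.measurableE.
move=> _ [_ [a ->] <-].
(* Rational trial points, clipped to b >= 1 and to [1, a] respectively. *)
pose p (q : rat) : R := Num.max 1 (ratr q).
pose pa (q : rat) : R := Num.max 1 (Num.min a (ratr q)).
have p1 q : 1 <= p q by rewrite le_max lexx.
have pa1 q : 1 <= pa q by rewrite le_max lexx.
have [a1|a1] := ltP a 1.
  rewrite (_ : _ `&` _ = `[0, +oo[%classic)//.
  apply/seteqP; split => z /=; rewrite !in_itv/= !andbT; first by case.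
  by move=> z0; split=> //; have [h _ _] := amaxP k z z0; exact: lt_le_trans h.
have -> : (`[0, +oo[ : set R) `&` amax k @^-1` `]a, +oo[ =
   \bigcup_n \bigcup_(q : rat) \bigcap_(q' : rat) ((`[0, +oo[ : set R) `&`
     [set z | slope k z (pa q') + n.+1%:R^-1 <= slope k z (p q)]).
  apply/seteqP; split => z /=.
    rewrite !in_itv/= !andbT => -[z0 az].
    have [b1 bmax bstrict] := amaxP k z z0; rewrite -/(amax k z) in b1 bmax bstrict.
    have [e e0 he] := bstrict a a1 az.
    have e20 : 0 < e / 2 by rewrite divr_gt0.
    have [dd d0 hd] := slope_approx k z0 b1 e20.
    have [q /andP[q1 q2]] := lt_eps_rat (amax k z) d0.
    (* One half of the margin e pays for moving the maximizer to a rational, the other half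
       dominates 1/(n+1). *)
    exists (Num.truncn (2 / e)) => //; exists q => // q' _; split => /=.
      by rewrite in_itv/= z0.
    have pq : p q = ratr q by rewrite /p (max_idPr _)// (le_trans b1)// ltW.
    have h1 : slope k z (amax k z) - e / 2 <= slope k z (p q).
      by rewrite pq; apply: hd; rewrite ltW.
    have h2 : slope k z (pa q') <= slope k z (amax k z) - e.
      by apply: he => //; rewrite ge_max a1 ge_min lexx.
    have h3 : (Num.truncn (2 / e)).+1%:R^-1 <= e / 2.
      rewrite -[e / 2]invrK invf_div lef_pV2 ?posrE ?divr_gt0//.
      by rewrite ltW// truncnS_gt.
    move: h1 h2 h3; move: ((Num.truncn _).+1%:R^-1) => u; lra.
  move=> [n _ [q _ h]].
  have z0 : 0 <= z by have [] := h 0 I; rewrite /= in_itv/= andbT.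
  rewrite !in_itv/= !andbT; split => //; rewrite ltNge; apply/negP => az.
  have [b1 bmax _] := amaxP k z z0; rewrite -/(amax k z) in b1 bmax.
  have n0 : 0 < (n.+1%:R : R)^-1 / 2 by rewrite divr_gt0// invr_gt0 ltr0n.
  have [dd d0 hd] := slope_approx k z0 b1 n0.
  have [q' /andP[q1 q2]] := lt_eps_rat (amax k z) d0.
  have [_ /=] := h q' I.
  have : slope k z (amax k z) - n.+1%:R^-1 / 2 <= slope k z (pa q').
    apply: hd; first by rewrite le_max le_min az (ltW q1) orbT.
    by rewrite ge_max ge_min (ltW q2) orbT andbT (le_trans b1)// lerDl ltW.
  have := bmax _ (p1 q); move: n0; move: (n.+1%:R^-1) => u; lra.
apply: bigcupT_measurable => n; apply: bigcupT_measurable_rat => q.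
rewrite -[X in measurable X]setCK setC_bigcap; apply: measurableC.
apply: bigcupT_measurable_rat => q'; apply: measurableC.
have mle : measurable_fun (`[0, +oo[ : set R)
    (fun z => slope k z (pa q') + n.+1%:R^-1 <= slope k z (p q)).
  apply: measurable_fun_ler; last exact: measurable_slope.
  by apply: measurable_funD => //; exact: measurable_slope.
exact: (mle _ [set true]).
Qed.

End Selection.

(** * Budget-driven policies *)

Section BudgetPolicy.
Context {d} {T : measurableType d} {R : realType}.
Variables (lr : T -> R) (bst : nat -> R -> R -> R).
Implicit Types (z c : R) (k : nat).

(** These definitions copy [next_state] and [psi_star] with the choice of the next budget left
    abstract. *)
Definition budget_step (s : R * R * nat) (x : T) : R * R * nat :=
  let: (z, c, k) := s in
  let b := bst k z c in
  (z * lr x, b - 1, if c < b then k.-1 else k).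

Definition stop_rule (s : R * R * nat) : R :=
  let: (z, c, k) := s in
  let b := bst k z c in if b < 1 then 1 else 1 - c / b.

Definition budget_policy z c k t (xs : t.-tuple T) : R :=
  stop_rule (foldl budget_step (z, c, k) xs).

Lemma shift_budget_policy z c k x :
  shift_rule x (budget_policy z c k) =
  budget_policy (z * lr x) (bst k z c - 1) (if c < bst k z c then k.-1 else k).
Proof. by []. Qed.

Lemma budget_policy0 z c k :
  budget_policy z c k [tuple] = if bst k z c < 1 then 1 else 1 - c / bst k z c.
Proof. by []. Qed.

Hypothesis bst0 : forall z c, bst 0 z c = c.
Hypothesis bstS : forall k z c, 0 <= z -> 0 <= c ->
  1 <= bst k.+1 z c /\ c <= bst k.+1 z c.
Hypothesis mbst : forall k,
  measurable_fun ((`[0, +oo[ : set R) `*` (`[0, +oo[ : set R))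
    (fun u => bst k u.1 u.2).
Hypotheses (lr0 : forall x, 0 <= lr x) (mlr : measurable_fun setT lr).

(* With no randomization left, the budget may become negative once the test
   has stopped for sure. *)
Let inv (s : R * R * nat) := (0 <= s.1.1) /\ (s.2 != 0%N -> 0 <= s.1.2).

Let inv_step s x : inv s -> inv (budget_step s x).
Proof.
case: s => -[z c] k /= [/= z0 c0]; split => /=; first exact: mulr_ge0.
case: k c0 => [|k] c0; first by case: ifP.
by move=> _; rewrite subr_ge0; case: (bstS k z0 (c0 isT)).
Qed.

Let inv_fold s (xs : seq T) : inv s -> inv (foldl budget_step s xs).
Proof. by elim: xs s => //= x xs IH s /inv_step-/(_ x)/IH. Qed.

Lemma stop_rule_itv s : inv s -> 0 <= stop_rule s <= 1.
Proof.
case: s => -[z c] [|k] [/= z0 c0].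
  rewrite bst0; case: ltP => c1; first by rewrite ler01 lexx.
  by rewrite divff ?subrr ?lexx ?ler01// gt_eqF// (lt_le_trans ltr01).
have [b1 cb] := bstS k z0 (c0 isT).
rewrite ltNge b1 /= gerBl subr_ge0 ler_pdivrMr ?(lt_le_trans ltr01)//.
by rewrite mul1r cb divr_ge0 ?(c0 isT)// (le_trans ler01).
Qed.

(* [bst] is only controlled on the nonnegative quadrant; this total extension
   agrees with it on all reachable states. *)
Let tbst k z c := if k == 0%N then c else bst k (Num.max 0 z) (Num.max 0 c).

Let tstep (s : R * R * nat) (x : T) : R * R * nat :=
  (s.1.1 * lr x, tbst s.2 s.1.1 s.1.2 - 1,
   if s.1.2 < tbst s.2 s.1.1 s.1.2 then s.2.-1 else s.2).

(** The clipping at 1 and the power make measurability direct; they reproduce division by b, which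
    is used only for b >= 1. *)
Let tstop_rule (s : R * R * nat) : R :=
  if tbst s.2 s.1.1 s.1.2 < 1 then 1
  else 1 - s.1.2 * (Num.max 1 (tbst s.2 s.1.1 s.1.2)) `^ (- 1).

Let tbstE s : inv s -> tbst s.2 s.1.1 s.1.2 = bst s.2 s.1.1 s.1.2.
Proof.
case: s => -[z c] [|k] [/= z0 c0]; first by rewrite /tbst bst0.
by rewrite /tbst (max_idPr z0) (max_idPr (c0 isT)).
Qed.

Let tstepE s x : inv s -> tstep s x = budget_step s x.
Proof. by case: s => -[z c] k /tbstE /= E; rewrite /tstep /= E. Qed.

Let tfoldE s (xs : seq T) : inv s -> foldl tstep s xs = foldl budget_step s xs.
Proof.
elim: xs s => //= x xs IH s invs; rewrite tstepE// IH//; exact: inv_step.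
Qed.

Let tstop_ruleE s : inv s -> tstop_rule s = stop_rule s.
Proof.
case: s => -[z c] k /tbstE /= E; rewrite /tstop_rule /= E.
case: ltP => // b1; rewrite ?(max_idPr b1) powR_inv1//.
exact: le_trans b1.
Qed.

Let measurable_nat_pair d' (A : measurableType d') d'' (B : measurableType d'')
    (f : A * nat -> B) :
  (forall k, measurable_fun setT (fun a => f (a, k))) -> measurable_fun setT f.
Proof.
move=> mf _ Y mY; rewrite setTI.
have -> : f @^-1` Y = \bigcup_k (((fun a => f (a, k)) @^-1` Y) `*` [set k]).
  apply/seteqP; split => [[a k] /= fY|[a k] [j _ [/= fY ->]]] //.
  by exists k.
apply: bigcupT_measurable => k; apply: measurableX => //.
by rewrite -[X in measurable X]setTI; exact: mf.
Qed.

Let measurable_tbst : measurable_fun setT (fun s : R * R * nat => tbst s.2 s.1.1 s.1.2).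
Proof.
apply: measurable_nat_pair => -[|k] /=; rewrite /tbst /=; first exact: measurable_snd.
have mD : measurable ((`[0, +oo[ : set R) `*` (`[0, +oo[ : set R)).
  exact: measurableX.
have mm : measurable_fun setT (fun a : R * R => (Num.max 0 a.1, Num.max 0 a.2)).
  by apply: measurable_fun_pair; apply: measurable_maxr.
have sub : (fun a : R * R => (Num.max 0 a.1, Num.max 0 a.2)) @` setT `<=`
    ((`[0, +oo[ : set R) `*` (`[0, +oo[ : set R)).
  move=> _ [a _ <-]; rewrite /= !in_itv/= !andbT !le_max lexx//.
exact: (measurable_comp mD sub (mbst k.+1) mm).
Qed.

Let measurable_tstep :
  measurable_fun setT (fun u : (R * R * nat) * T => tstep u.1 u.2).
Proof.
have mb : measurable_fun setT
    (fun u : (R * R * nat) * T => tbst u.1.2 u.1.1.1 u.1.1.2).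
  exact: measurableT_comp measurable_tbst measurable_fst.
have mz : measurable_fun setT (fun u : (R * R * nat) * T => u.1.1.1).
  by do 3 apply: measurableT_comp => //.
have mc : measurable_fun setT (fun u : (R * R * nat) * T => u.1.1.2).
  by do 3 apply: measurableT_comp => //.
have mk : measurable_fun setT (fun u : (R * R * nat) * T => u.1.2).
  by do 2 apply: measurableT_comp => //.
apply: measurable_fun_pair; first apply: measurable_fun_pair.
- by apply: measurable_funM => //; exact: measurableT_comp mlr measurable_snd.
- exact: measurable_funB.
- apply: measurable_fun_ifT => //; first exact: measurable_fun_ltr.
  exact: measurableT_comp.
Qed.

Let measurable_tfold t :
  measurable_fun setT (fun u : (R * R * nat) * t.-tuple T => foldl tstep u.1 u.2).
Proof.
elim: t => [|t IH].
  rewrite (_ : (fun _ => _) = fst) //.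
  by apply/funext => -[s xs]; rewrite (tuple0 xs).
rewrite (_ : (fun _ => _) = (fun u : (R * R * nat) * t.-tuple T => foldl tstep u.1 u.2) \o
  (fun u : (R * R * nat) * t.+1.-tuple T =>
     (tstep u.1 (thead u.2), [tuple of behead u.2]))); last first.
  by apply/funext => -[s xs]; rewrite /= [in LHS](tuple_eta xs).
apply: measurableT_comp => //; apply: measurable_fun_pair.
  have -> : (fun u : (R * R * nat) * t.+1.-tuple T => tstep u.1 (thead u.2)) =
    (fun v : (R * R * nat) * T => tstep v.1 v.2) \o
    (fun u : (R * R * nat) * t.+1.-tuple T => (u.1, thead u.2)) by [].
  apply: measurableT_comp => //; apply: measurable_fun_pair => //.
  by apply: (measurableT_comp (measurable_tnth ord0)); exact: measurable_snd.
by apply: (measurableT_comp (@measurable_behead _ T t)); exact: measurable_snd.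
Qed.

Let measurable_tstop_rule : measurable_fun setT tstop_rule.
Proof.
apply: measurable_fun_ifT => //; first exact: measurable_fun_ltr.
apply: measurable_funB => //; apply: measurable_funM.
  by apply: measurableT_comp => //; exact: measurable_fst.
apply: (measurableT_comp (measurable_powR _)).
exact: measurable_maxr.
Qed.

Lemma randomized_rule_budget_policy z c k : 0 <= z -> 0 <= c ->
  randomized_rule (budget_policy z c k).
Proof.
move=> z0 c0 t; have invs : inv (z, c, k) by split.
split; last by move=> xs; apply: stop_rule_itv; exact: inv_fold.
rewrite (_ : budget_policy _ _ _ (t := t) = tstop_rule \o
   (fun xs : t.-tuple T => foldl tstep (z, c, k) xs)).
  apply: measurableT_comp => //.
  have -> : (fun xs : t.-tuple T => foldl tstep (z, c, k) xs) =
    (fun u : (R * R * nat) * t.-tuple T => foldl tstep u.1 u.2) \o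
    (fun xs : t.-tuple T => ((z, c, k), xs)) by [].
  apply: measurableT_comp; first exact: measurable_tfold.
  by apply: measurable_fun_pair.
apply/funext => xs; rewrite /= tfoldE// tstop_ruleE//; exact: inv_fold.
Qed.

(** The possible moves: stop, continue for sure with budget c - 1, or randomize, after which the
    budget b - 1 may exceed c but k has dropped. *)
Lemma policy_ind (Q : R -> R -> nat -> Prop) :
  (forall z c, 0 <= z -> 0 <= c -> c < 1 -> Q z c 0%N) ->
  (forall z c k, 0 <= z -> 1 <= c -> bst k z c = c ->
     (forall z', 0 <= z' -> Q z' (c - 1) k) -> Q z c k) ->
  (forall z c k, 0 <= z -> 0 <= c -> 1 <= bst k.+1 z c -> c < bst k.+1 z c ->
     (forall z', 0 <= z' -> Q z' (bst k.+1 z c - 1) k) -> Q z c k.+1) ->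
  forall z c k, 0 <= z -> 0 <= c -> Q z c k.
Proof.
move=> Qstop Qcont Qrand z c k; elim: k => [|k IHk] in z c *.
  move=> z0 c0; elim/(@real_nat_ind R): c / c0 z z0 => c h.
    by move=> c1 z z0; exact: Qstop.
  by move=> IH z z0; apply: Qcont.
move=> z0 c0; elim/(@real_nat_ind R): c / c0 z z0 => c h.
  move=> c1 z z0; have [b1 cb] := bstS k z0 h.
  apply: Qrand => //; first exact: lt_le_trans b1.
  by move=> z' z'0; apply: IHk => //; rewrite subr_ge0.
move=> IH z z0; have c0 : 0 <= c by exact: le_trans h.
have [b1 cb] := bstS k z0 c0.
have [bc|cb'] := eqVneq (bst k.+1 z c) c; first exact: Qcont.
apply: Qrand => //; first by rewrite lt_neqAle eq_sym cb' cb.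
by move=> z' z'0; apply: IHk => //; rewrite subr_ge0.
Qed.

(** A randomized step survives with probability c/b and then uses one observation and at most b - 1
    further ones on average: c in total. *)
Lemma mean_run_length_budget_policy z c k x : 0 <= z -> 0 <= c ->
  (mean_run_length (budget_policy z c k) x <= c%:E)%E.
Proof.
move=> z0 c0; move: z c k z0 c0 x.
apply: policy_ind => [z c z0 c0 c1 x|z c k z0 c1 bc IH x|z c k z0 c0 b1 cb IH x].
- rewrite mean_run_lengthE; last exact: randomized_rule_budget_policy.
  by rewrite budget_policy0 bst0 c1 subrr mul0e lee_fin.
- have c0 : 0 <= c by exact: le_trans c1.
  rewrite mean_run_lengthE; last exact: randomized_rule_budget_policy.
  rewrite budget_policy0 shift_budget_policy bc ltNge c1 /= ltxx.
  rewrite divff ?gt_eqF ?(lt_le_trans ltr01)// subrr subr0 mul1e.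
  have := IH (z * lr (x 0%N)) (mulr_ge0 z0 (lr0 _)) (x \o succn).
  by move=> /(leeD2l 1%:E)/le_trans; apply; rewrite -EFinD lee_fin; lra.
- rewrite mean_run_lengthE; last exact: randomized_rule_budget_policy.
  rewrite budget_policy0 shift_budget_policy cb ltNge b1 /=.
  have b0 := lt_le_trans ltr01 b1.
  have := IH (z * lr (x 0%N)) (mulr_ge0 z0 (lr0 _)) (x \o succn).
  move=> /(leeD2l 1%:E) h; rewrite subKr.
  apply: (@le_trans _ _ ((c / bst k.+1 z c)%:E * (bst k.+1 z c)%:E)%E).
    apply: lee_wpmul2l; first by rewrite lee_fin divr_ge0// ltW.
    by apply: le_trans h _; rewrite -EFinD lee_fin; lra.
  by rewrite -EFinM divfK// gt_eqF.
Qed.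

Lemma num_randomized_budget_policy z c k x t : 0 <= z -> 0 <= c ->
  0 < stop_prob (budget_policy z c k) x t ->
  (num_randomized (budget_policy z c k) x t <= k)%N.
Proof.
move=> z0 c0; move: z c k z0 c0 x t.
apply: policy_ind => [z c z0 c0 c1 x t|z c k z0 c1 bc IH x t|z c k z0 c0 b1 cb IH x t].
- have E : budget_policy z c 0 [tuple] = 1 by rewrite budget_policy0 bst0 c1.
  case: t => [|t]; last by rewrite stop_probS E subrr mul0r ltxx.
  by move=> _; rewrite /num_randomized big_ord1 history0 E ltxx andbF.
- have E : budget_policy z c k [tuple] = 0.
    rewrite budget_policy0 bc ltNge c1 /= divff ?subrr//.
    by rewrite gt_eqF// (lt_le_trans ltr01).
  case: t => [|t]; first by rewrite stop_prob0 E ltxx.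
  rewrite stop_probS num_randomizedS E subr0 mul1r ltxx add0n.
  rewrite shift_budget_policy bc ltxx; apply: IH.
  exact: mulr_ge0.
- have rb := randomized_rule_budget_policy k.+1 z0 c0.
  case: t => [|t].
    by move=> _; rewrite /num_randomized big_ord1; case: (_ && _).
  rewrite stop_probS num_randomizedS => sp.
  rewrite -(add1n k); apply: leq_add; first by case: (_ && _).
  move: sp; rewrite shift_budget_policy cb /= => sp; apply: IH.
    exact: mulr_ge0.
  rewrite lt_neqAle stop_prob_ge0 ?andbT.
    by apply: contraTN sp => /eqP <-; rewrite mulr0 ltxx.
  apply: randomized_rule_budget_policy; first exact: mulr_ge0.
  by rewrite subr_ge0.
Qed.

Lemma admissible_budget_policy z c k : 0 <= z -> 0 <= c ->
  admissible_rand (budget_policy z c k) c k.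
Proof.
move=> z0 c0; split; first split.
- exact: randomized_rule_budget_policy.
- by move=> x; exact: mean_run_length_budget_policy.
- by move=> x t; exact: num_randomized_budget_policy.
Qed.

End BudgetPolicy.

(** * Optimality *)

Section Optimality.
Context {d dO} {T : measurableType d} {Omega : measurableType dO} {R : realType}.
Variables (X : nat -> {mfun Omega >-> T}) (Q0 : probability Omega R).
Variables (P0 P1 : probability T R).
Variables (mu : {measure set T -> \bar R}) (p0 p1 : T -> R).
Hypotheses (iid0 : iid Q0 X P0).
Hypotheses (density0 : is_density mu P0 p0) (density1 : is_density mu P1 p1).
Hypothesis P1_ac_P0 : P1 `<< P0.
Implicit Types (z c b y : R) (k : nat) (psi : forall t, t.-tuple T -> R).

Local Notation lr := (lr p0 p1).
Local Notation cost := (cost X Q0 p0 p1).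
Local Notation value := (value P0 lr).
Local Notation cont_value := (cont_value P0 lr).
Local Notation slope := (slope P0 lr).

Let lr0 := lr_ge0 density0 density1.
Let mlr := measurable_lr density0 density1.
Let int_lr := integral_lr density0 density1 P1_ac_P0.
Let loss k : loss_fun (value k) := loss_fun_value lr0 mlr int_lr k.

Let risk_value k c : 0 <= c -> risk_fun (value k ^~ c).
Proof. by case: (loss k) => r _ _; exact: r. Qed.

Let zlr z x : 0 <= z -> 0 <= z * lr x.
Proof. by move=> z0; apply: mulr_ge0. Qed.

Lemma integral_value k z c : 0 <= z -> 1 <= c ->
  (\int[P0]_x (value k (z * lr x) (c - 1))%:E = (cont_value k z c)%:E)%E.
Proof.
move=> z0 c1; have c10 : 0 <= c - 1 by rewrite subr_ge0.
rewrite /cont_value /avg unlock fineK//.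
apply: (integrable_fin_num measurableT).
exact: (integrable_risk_lr P0 lr0 mlr z0 (risk_value k c10)).
Qed.

(** Sequences that start with [a] are among those for which the bound is assumed; the one-step
    equation is solved for the tail. *)
Lemma mean_run_length_shift psi (a : T) c : randomized_rule psi ->
  psi 0%N [tuple] < 1 -> (forall x, mean_run_length psi x <= c%:E)%E ->
  forall x, (mean_run_length (shift_rule a psi) x <=
             (c / (1 - psi 0%N [tuple]) - 1)%:E)%E.
Proof.
move=> rpsi psi1 hc x; set q := 1 - _; have q0 : 0 < q by rewrite subr_gt0.
pose y n := if n is n'.+1 then x n' else a.
have := hc y; rewrite (mean_run_lengthE _ rpsi) /= -/q.
have -> : y \o succn = x by [].
rewrite -lee_pdivlMl// -EFinM mulrC => h.
by rewrite EFinB leeBrDl.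
Qed.

Lemma admissible_shift psi (a : T) c k : admissible_rand psi c k ->
  psi 0%N [tuple] < 1 ->
  admissible_rand (shift_rule a psi) (c / (1 - psi 0%N [tuple]) - 1)
    (if 0 < psi 0%N [tuple] then k.-1 else k).
Proof.
move=> [[rpsi hc] hk] psi1; split; first split.
- exact: randomized_rule_shift.
- exact: mean_run_length_shift.
move=> x t sp.
pose y n := if n is n'.+1 then x n' else a.
have := hk y t.+1; rewrite stop_probS num_randomizedS /= psi1 andbT.
have -> : y \o succn = x by [].
rewrite mulr_gt0 ?subr_gt0// => /(_ isT).
case: ifP => _ /=; last by rewrite add0n.
by case: k {hk} => // k; rewrite add1n ltnS.
Qed.

(** The remaining budget bounds a run length, which is nonnegative. *)
Lemma admissible_ge psi c k : admissible_rand psi c k -> psi 0%N [tuple] < 1 ->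
  1 <= c / (1 - psi 0%N [tuple]).
Proof.
move=> [[rpsi hc] _] psi1.
have := mean_run_length_shift point rpsi psi1 hc (fun=> point).
move=> /(le_trans (mean_run_length_ge0 (randomized_rule_shift _ rpsi) _)).
by rewrite lee_fin subr_ge0.
Qed.

Let cost_ge_cont psi k z b : randomized_rule psi -> 0 <= z -> 1 <= b ->
  psi 0%N [tuple] < 1 ->
  (forall x y, 0 <= y -> ((value k y (b - 1))%:E <= cost (shift_rule x psi) y)%E) ->
  ((psi 0%N [tuple] * g z + (1 - psi 0%N [tuple]) * cont_value k z b)%:E <=
    cost psi z)%E.
Proof.
move=> rpsi z0 b1 psi1 h; rewrite (cost_step iid0 density0 density1)//.
rewrite EFinD EFinM leeD2l// EFinM -integral_value//.
apply: lee_wpmul2l; first by rewrite lee_fin subr_ge0 ltW.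
have b10 : 0 <= b - 1 by rewrite subr_ge0.
have rv := risk_value k b10.
apply: ge0_le_integral => //.
- by move=> x _; rewrite lee_fin; case/andP: (rv.1 _ (zlr x z0)).
- by apply/measurable_EFinP; exact: (measurable_risk_lr lr0 mlr z0 rv).
- exact: (measurable_cost_shift X Q0 density0 density1).
- by move=> x _; apply: h; exact: zlr.
Qed.

(** The decision at time 0 is one of those over which the recursion minimizes, and the rest of the
    policy is admissible for the resulting state, where the induction applies. *)
Lemma value_le_cost psi k z c : 0 <= z -> 0 <= c -> admissible_rand psi c k ->
  ((value k z c)%:E <= cost psi z)%E.
Proof.
move=> z0 c0.
pose Q k c := forall psi z, 0 <= z -> admissible_rand psi c k ->
  ((value k z c)%:E <= cost psi z)%E.
suff: Q k c by apply.
have step k' c' : 0 <= c' -> (1 <= c' -> Q k' (c' - 1)) ->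
    (forall k'', k' = k''.+1 -> forall b, 1 <= b -> Q k'' (b - 1)) -> Q k' c'.
  move=> {}c0 IHc IHk {}psi {}z {}z0 adm; have [[rpsi hc] hk] := adm.
  have psi_le1 := rule_le1 rpsi [tuple]; have psi_ge0 := rule_ge0 rpsi [tuple].
  have [psi1|psi1] := eqVneq (psi 0%N [tuple]) 1.
    rewrite (cost_stop _ _ density0 density1)// lee_fin.
    by case/andP: ((risk_value k' c0).1 z z0).
  have {}psi1 : psi 0%N [tuple] < 1 by rewrite lt_neqAle psi1.
  have b1 := admissible_ge adm psi1.
  have adm' a := admissible_shift a adm psi1.
  have [psi0|psi0] := ltP 0 (psi 0%N [tuple]); last first.
    have {psi0} psi0 : psi 0%N [tuple] = 0 by apply/eqP; rewrite eq_le psi0.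
    rewrite psi0 subr0 divr1 in b1.
    have := cost_ge_cont (k := k') rpsi z0 b1 psi1.
    rewrite psi0 mul0r add0r subr0 mul1r => h; apply: le_trans (h _).
      by rewrite lee_fin value_le_cont.
    move=> x y y0; apply: (IHc b1) => //.
    by have := adm' x; rewrite psi0 ltxx subr0 divr1.
  (* T = 0 has positive probability and such a run has already used one randomized decision. *)
  have : (0 < k')%N.
    have := hk (fun=> point) 0%N; rewrite stop_prob0 psi0 => /(_ isT).
    by rewrite /num_randomized big_ord1 history0 psi0 psi1.
  case: k' => // k' in hk IHc IHk adm adm' b1 *; move=> _.
  set b := c' / (1 - psi 0%N [tuple]) in b1 adm' *.
  have q0 : 0 < 1 - psi 0%N [tuple] by rewrite subr_gt0.
  apply: le_trans (cost_ge_cont (k := k') rpsi z0 b1 psi1 _); last first.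
    move=> x y y0; apply: (IHk k') => //.
    by have := adm' x; rewrite psi0.
  have cb : c' = (1 - psi 0%N [tuple]) * b by rewrite mulrC divfK// gt_eqF.
  rewrite lee_fin; apply: le_trans (value_le_slope lr0 mlr int_lr (b := b) k' z0 c0 _) _.
    by rewrite ge_max b1 /= cb ler_piMl ?(le_trans ler01)// gerBl.
  by rewrite {1}cb -mulrA slopeE//; lra.
elim: k => [|k IHk] in c c0 *.
  elim/(@real_nat_ind R): c / c0 => c h.
    by move=> c1; apply: step => // /(lt_le_trans c1); rewrite ltxx.
  by move=> IH; apply: step => //; exact: le_trans h.
have IHk' k'' : k.+1 = k''.+1 -> forall b, 1 <= b -> Q k'' (b - 1).
  by move=> [<-] b b1; apply: IHk; rewrite subr_ge0.
elim/(@real_nat_ind R): c / c0 => c h.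
  by move=> c1; apply: step => // /(lt_le_trans c1); rewrite ltxx.
by move=> IH; apply: step => //; exact: le_trans h.
Qed.

Section policy.
Variable bst : nat -> R -> R -> R.
Hypothesis bst0 : forall z c, bst 0 z c = c.
Hypothesis bstS : forall k z c, 0 <= z -> 0 <= c ->
  1 <= bst k.+1 z c /\ c <= bst k.+1 z c.
Hypothesis mbst : forall k,
  measurable_fun ((`[0, +oo[ : set R) `*` (`[0, +oo[ : set R))
    (fun u => bst k u.1 u.2).
(** The choice attains the minimum in the recursion, a raised budget marking the gamble. *)
Hypothesis bst_opt : forall k z c, 0 <= z -> 0 <= c ->
  value k.+1 z c = if c < bst k.+1 z c then g z - c * slope k z (bst k.+1 z c)
                   else cont_value k.+1 z c.

Lemma cost_budget_policy z c k : 0 <= z -> 0 <= c ->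
  cost (budget_policy lr bst z c k) z = (value k z c)%:E.
Proof.
move=> z0 c0; have rp z' c' k' := @randomized_rule_budget_policy _ _ _ lr bst
  bst0 bstS mbst lr0 mlr z' c' k'.
move: z c k z0 c0; apply: (policy_ind bst0 bstS) => [z c z0 c0 c1|z c k z0 c1 bc IH|
    z c k z0 c0 b1 cb IH].
- rewrite (cost_stop _ _ density0 density1).
  + by rewrite value_lt1.
  + exact: rp.
  + by [].
  + by rewrite budget_policy0 bst0 c1.
- have c0 : 0 <= c by exact: le_trans c1.
  have E : budget_policy lr bst z c k [tuple] = 0.
    rewrite budget_policy0 bc ltNge c1 /= divff ?subrr//.
    by rewrite gt_eqF// (lt_le_trans ltr01).
  rewrite (cost_step iid0 density0 density1); [|exact: rp|by []|by rewrite E].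
  rewrite E mul0r add0e subr0 mul1e.
  under eq_integral do rewrite shift_budget_policy bc ltxx (IH _ (zlr _ z0)).
  rewrite integral_value//; congr (_%:E).
  (* Without randomization the only alternative is to stop at cost g z, which is never below the
     cost of continuing. *)
  case: k {IH E} bc => [|k] bc; last by rewrite bst_opt// bc ltxx.
  rewrite value_ge1//; apply/esym/min_idPr.
  by case/andP: (cont_value_itv lr0 mlr int_lr (loss 0) z0 c1).
- have b0 := lt_le_trans ltr01 b1.
  have E : budget_policy lr bst z c k.+1 [tuple] = 1 - c / bst k.+1 z c.
    by rewrite budget_policy0 ltNge b1.
  rewrite bst_opt// cb.
  (* With c = 0 the stopping probability is 1, a case outside [cost_step]. *)
  have [cz|cn0] := eqVneq c 0.
    rewrite (cost_stop _ _ density0 density1).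
    + by rewrite cz mul0r subr0.
    + exact: rp.
    + by [].
    + by rewrite E cz mul0r subr0.
  have c_gt0 : 0 < c by rewrite lt_neqAle eq_sym cn0.
  rewrite (cost_step iid0 density0 density1); [|exact: rp|by []|]; last first.
    by rewrite E ltrBlDr ltrDl divr_gt0.
  rewrite E; under eq_integral do rewrite shift_budget_policy cb /= (IH _ (zlr _ z0)).
  rewrite integral_value// -EFinM -EFinD; congr (_%:E).
  by rewrite /slope; field; rewrite gt_eqF.
Qed.

End policy.

End Optimality.

(** * The optimal budget *)

Section BudgetSelection.
Context {d} {T : measurableType d} {R : realType}.
Variables (P : probability T R) (lr : T -> R).
Hypotheses (lr0 : forall x, 0 <= lr x) (mlr : measurable_fun setT lr).
Hypothesis int_lr : (\int[P]_x (lr x)%:E = 1)%E.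
Implicit Types (z c b : R) (k : nat).
Local Notation value := (value P lr).
Local Notation cont_value := (cont_value P lr).
Local Notation slope := (slope P lr).
Local Notation gamble := (gamble P lr).

Let loss k : loss_fun (value k) := loss_fun_value lr0 mlr int_lr k.

(** Placeholders for [mean_rho] and [r], first filled with [cont_value] and [slope] while [rho] is
    still unknown. *)
Variables (E rr : nat -> R -> R -> R) (amax : nat -> R -> R).
Hypothesis EE : forall k z c, 0 <= z -> 1 <= c -> E k z (c - 1) = cont_value k z c.
Hypothesis rrE : forall k z b, 0 <= z -> 1 <= b -> rr k z b = slope k z b.
Hypothesis amaxP : forall k, measurable_fun (`[0, +oo[ : set R) (amax k) /\
  forall z, 0 <= z -> is_max_on (rr k z) 1 (amax k z).

Definition next_budget k z c : R :=
  if (k == 0%N) || ((1 <= c) &&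
     `[< E k z (c - 1) <= g z - c * sup [set rr k.-1 z b | b in `[c, +oo[] >])
  then c else amax k.-1 z.

Lemma next_budget0 z c : next_budget 0 z c = c.
Proof. by []. Qed.

Let amax_ge1 k z : 0 <= z -> 1 <= amax k z.
Proof. by case: (amaxP k) => _ h /h []. Qed.

Let amax_max k z : 0 <= z -> forall b, 1 <= b -> slope k z b <= slope k z (amax k z).
Proof.
move=> z0 b b1; rewrite -!rrE ?amax_ge1//.
by case: (amaxP k) => _ /(_ z z0) [_]; exact.
Qed.

(** C_k compares the sure continuation with the best gamble, so it holds exactly when continuing for
    sure attains the value. *)
Lemma next_budgetE k z c : 0 <= z ->
  next_budget k.+1 z c =
  if (1 <= c) && (cont_value k.+1 z c <= value k.+1 z c) then c else amax k z.
Proof.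
move=> z0; rewrite /next_budget /=; case: (boolP (1 <= c)) => //= c1.
rewrite asboolb EE// value_ge1// le_min lexx andbT.
rewrite (_ : sup _ = sup [set slope k z b | b in `[Num.max 1 c, +oo[])//.
congr sup; rewrite (max_idPr c1); apply: eq_imagel => b /=.
by rewrite in_itv/= andbT => cb; rewrite rrE// (le_trans c1).
Qed.

Lemma next_budget_ge k z c : 0 <= z -> 0 <= c ->
  1 <= next_budget k.+1 z c /\ c <= next_budget k.+1 z c.
Proof.
move=> z0 c0; rewrite next_budgetE//; case: ifP => [/andP[c1 _]//|h].
have a1 := amax_ge1 k z0; split => //.
(* A maximizer below c would make the sure continuation optimal by [cont_le_gamble], against the
   failed test. *)
rewrite leNgt; apply/negP => ac; move: h.
have c1 := le_trans a1 (ltW ac).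
rewrite c1 value_ge1// le_min lexx andbT => /negP; apply.
exact: (cont_le_gamble lr0 mlr int_lr z0 c1 a1 (ltW ac) (amax_max k z0)).
Qed.

Lemma next_budget_opt k z c : 0 <= z -> 0 <= c ->
  value k.+1 z c = if c < next_budget k.+1 z c
                   then g z - c * slope k z (next_budget k.+1 z c)
                   else cont_value k.+1 z c.
Proof.
move=> z0 c0; have [b1 cb] := next_budget_ge k z0 c0.
move: b1 cb; rewrite next_budgetE//; case: ifP => [/andP[c1 h] _ _|h a1 ca].
  by rewrite ltxx; apply/eqP; rewrite eq_le h andbT value_le_cont.
have gE : gamble k.+1 z c = g z - c * slope k z (amax k z).
  apply: (gamble_argmax (k := k)); first by rewrite ge_max a1.
  by move=> b' mb'; apply: amax_max => //; move: mb'; rewrite ge_max => /andP[].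
(* Equality is excluded in the same way, so whenever the test fails the budget is strictly
   raised. *)
have ca' : c < amax k z.
  rewrite lt_neqAle ca andbT; apply/eqP => cE; move: h; rewrite {1}cE a1 /=.
  have c1 : 1 <= c by rewrite cE.
  rewrite value_ge1// le_min lexx andbT => /negP; apply.
  apply: (cont_le_gamble lr0 mlr int_lr z0 c1 a1 _ (amax_max k z0)).
  by rewrite cE.
rewrite ca' -gE; have [c1|c1] := ltP c 1; first by rewrite value_lt1.
move: h; rewrite c1 value_ge1// le_min lexx andbT /= => /negbT.
by rewrite -ltNge => /ltW /min_idPl.
Qed.

Lemma measurable_next_budget k :
  measurable_fun ((`[0, +oo[ : set R) `*` (`[0, +oo[ : set R))
    (fun u => next_budget k u.1 u.2).
Proof.
case: k => [|k]; first exact: measurable_funTS measurable_snd.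
set D := _ `*` _; have mD : measurable D by exact: measurableX.
pose D1 := (`[0, +oo[ : set R) `*` (`[1, +oo[ : set R).
have mD1 : measurable D1 by exact: measurableX.
apply: (eq_measurable_fun (fun u : R * R =>
  if (1 <= u.2) && (cont_value k.+1 u.1 u.2 <= value k.+1 u.1 u.2)
  then u.2 else amax k u.1)).
  by move=> u; rewrite inE => -[/=]; rewrite in_itv/= andbT => z0 _; rewrite next_budgetE.
apply: measurable_fun_if => //.
(* The comparison matters only for c >= 1, where both sides are monotone and right-continuous in the
   budget, hence jointly measurable. *)
- apply: (measurable_fun_bool true).
  rewrite (_ : _ `&` _ = D1 `&`
      (fun u : R * R => cont_value k.+1 u.1 u.2 <= value k.+1 u.1 u.2) @^-1` [set true]).
    have [_ va vl] := loss k.+1.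
    have mc : measurable_fun D1 (fun u : R * R => cont_value k.+1 u.1 u.2).
      apply: (measurable_mono2 (m := 1)) => //.
      + by move=> c z z' c1 z0 zz'; exact: (cont_value_mono lr0 mlr int_lr (loss k.+1)).
      + by move=> z c c' z0 c1 cc'; exact: (cont_value_anti lr0 mlr (loss k.+1)).
      + by move=> z c c' z0 c1 cc' tc; exact: (cont_value_lip lr0 mlr (loss k.+1)).
    have mv : measurable_fun D (fun u : R * R => value k.+1 u.1 u.2).
      apply: (measurable_mono2 (m := 0)) => // c z z' c0 z0 zz'.
      by have [r _ _] := loss k.+1; have [_] := r c c0; exact.
    have D1D : D1 `<=` D.
      move=> [z c] [/= h]; rewrite /D /= !in_itv/= !andbT => c1.
      by move: h; rewrite in_itv/= andbT => ->; rewrite (le_trans ler01).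
    have mv1 := measurable_funS mD D1D mv.
    have mle := measurable_fun_ler mc mv1.
    by apply: mle.
  apply/seteqP; split => [[z c]|[z c]] /=; rewrite /D /D1 /= !in_itv/= !andbT.
    by move=> [[z0 c0] /andP[-> ->]].
  by move=> [[z0 c1] h]; rewrite z0 c1 h (le_trans ler01).
- exact: measurable_funTS measurable_snd.
- have [ma _] := amaxP k.
  set D' := _ `&` _; have sub : fst @` D' `<=` (`[0, +oo[ : set R).
    by move=> _ [u [[h _] _] <-].
  have mF : measurable (`[0, +oo[ : set R) by [].
  have mfst : measurable_fun D' (@fst R R) by exact: measurable_funTS.
  exact: (measurable_comp mF sub ma mfst).
Qed.

End BudgetSelection.

(** * Identification of rho_k with the value function and optimality of [psi_star] *)

Theorem theorem4p4 (R : realType) (d dO : measure_display)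
  (T : measurableType d) (Omega : measurableType dO)
  (X : nat -> {mfun Omega >-> T}) (Q0 Q1 : probability Omega R)
  (P0 P1 : probability T R)
  (mu : {measure set T -> \bar R}) (p0 p1 : T -> R)
  (tie : forall t, t.-tuple T -> R)
  (iid0 : iid Q0 X P0) (iid1 : iid Q1 X P1)
  (density0 : is_density mu P0 p0) (density1 : is_density mu P1 p1)
  (P1_ac_P0 : P1 `<< P0)
  (kl_neq0 : kl_divergence P0 P1 p0 p1 <> 0%E)
  (kl_fin : kl_divergence P0 P1 p0 p1 \is a fin_num)
  (tie_rule : randomized_rule tie) :
  (forall (k : nat) (z c : R), 0 <= z -> 1 <= c ->
     exists b, is_max_on (r Q0 Q1 X p0 p1 tie P0 k z) c b) /\
  (exists amax, argmax_selection Q0 Q1 X p0 p1 tie P0 amax) /\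
  (forall amax, argmax_selection Q0 Q1 X p0 p1 tie P0 amax ->
   forall (z c : R) (k : nat), 0 <= z -> 0 <= c ->
     let psi := psi_star Q0 Q1 X p0 p1 tie P0 amax z c k in
     admissible_rand psi c k /\
     alpha Q0 X p0 p1 tie psi z + z * beta Q1 X p0 p1 tie psi z =
       rho Q0 Q1 X p0 p1 tie k z c).
Proof.
pose lr := lr p0 p1.
have lr0 : forall x, 0 <= lr x := lr_ge0 density0 density1.
have mlr : measurable_fun setT lr := measurable_lr density0 density1.
have int_lr := integral_lr density0 density1 P1_ac_P0.
have loss k := loss_fun_value lr0 mlr int_lr k.
have risk psi z (rpsi : randomized_rule psi) (z0 : 0 <= z) :
    cost X Q0 p0 p1 psi z =
    (alpha Q0 X p0 p1 tie psi z + z * beta Q1 X p0 p1 tie psi z)%:E.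
  exact: (alpha_beta_cost iid0 iid1 density0 density1 P1_ac_P0 tie_rule).
(* With [mean_rho] and [r] for [E] and [rr], this policy is convertible with [psi_star]. *)
have optimal E rr amax
    (EE : forall k (z c : R), 0 <= z -> 1 <= c -> E k z (c - 1) = cont_value P0 lr k z c)
    (rrE : forall k (z b : R), 0 <= z -> 1 <= b -> rr k z b = slope P0 lr k z b)
    (amaxP : forall k, measurable_fun (`[0, +oo[ : set R) (amax k) /\
       forall z : R, 0 <= z -> is_max_on (rr k z) 1 (amax k z))
    z c k (z0 : 0 <= z) (c0 : 0 <= c) :
    let psi := @budget_policy _ T R lr (next_budget E rr amax) z c k in
    admissible_rand psi c k /\
    alpha Q0 X p0 p1 tie psi z + z * beta Q1 X p0 p1 tie psi z = value P0 lr k z c.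
  have n0 := next_budget0 E rr amax.
  have nS := next_budget_ge lr0 mlr int_lr EE rrE amaxP.
  have nM := measurable_next_budget lr0 mlr int_lr EE rrE amaxP.
  have nO := next_budget_opt lr0 mlr int_lr EE rrE amaxP.
  move=> psi; have adm : admissible_rand psi c k by exact: admissible_budget_policy.
  split => //; apply: EFin_inj; rewrite -risk//; last by case: adm => -[].
  exact: (cost_budget_policy iid0 density0 density1 P1_ac_P0 n0 nS nM nO).
have rhoE k (z c : R) : 0 <= z -> 0 <= c ->
    rho Q0 Q1 X p0 p1 tie k z c = value P0 lr k z c.
  move=> z0 c0.
  have [amax amaxP] := argmax_selection_value lr0 mlr int_lr.
  (* A first optimal policy, built from [value] alone; the shift c + 1 undoes the argument c - 1 of
     [E]. *)
  have [|adm opt] := optimal (fun k z c => cont_value P0 lr k z (c + 1))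
    (slope P0 lr) amax _ (fun _ _ _ _ _ => erefl) amaxP z c k z0 c0.
    by move=> k' z' c' _ _; rewrite subrK.
  have lb : lbound [set alpha Q0 X p0 p1 tie psi z + z * beta Q1 X p0 p1 tie psi z
      | psi in [set psi | admissible_rand psi c k]] (value P0 lr k z c).
    move=> _ [psi adm' <-]; rewrite -lee_fin -risk//; last by case: adm' => -[].
    exact: (value_le_cost iid0 density0 density1 P1_ac_P0).
  apply/eqP; rewrite eq_le; apply/andP; split.
    rewrite -opt; apply: ge_inf; first by exists (value P0 lr k z c).
    by eexists; [exact: adm|].
  by apply: lb_le_inf => //; eexists; eexists; [exact: adm|].
have EE k (z c : R) : 0 <= z -> 1 <= c ->
    mean_rho Q0 Q1 X p0 p1 tie P0 k z (c - 1) = cont_value P0 lr k z c.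
  move=> z0 c1; rewrite /mean_rho /cont_value /avg; congr (fine (expectation _ _)).
  by apply/funext => x; rewrite rhoE ?subr_ge0// mulr_ge0.
have rrE k (z b : R) : 0 <= z -> 1 <= b ->
    r Q0 Q1 X p0 p1 tie P0 k z b = slope P0 lr k z b.
  by move=> z0 b1; rewrite /r EE.
split=> [k z c z0 c1|].
  have [b [cb bmax _]] := slope_argmax lr0 mlr int_lr (loss k) z0 c1.
  exists b; split => // b' cb'; rewrite !rrE ?(le_trans c1)//.
  exact: bmax.
split.
  have [amax amaxP] := argmax_selection_value lr0 mlr int_lr.
  exists amax => k; have [ma amax_max] := amaxP k; split => // z z0.
  have [a1 h] := amax_max z z0; split => // b b1.
  by rewrite !rrE//; exact: h.
move=> amax amaxP z c k z0 c0 psi; rewrite rhoE//.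
exact: (optimal _ _ amax EE rrE amaxP z c k z0 c0).
Qed.
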